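(* Let $\tau_0,\tau_1>0$, $n\ge1$, $\lambda_i>0$ with $\sum_{i=1}^n\lambda_i=1$, $a_i>0$, $\mu_i=\mathcal N(m_i,\Sigma_i)$ with $m_i\in\mathbb R^d$, $\Sigma_i\in\mathbb S_{++}^d$. For $\nu=\mathcal N(m,\Sigma)\in\mathcal G_d^1$ let $$\omega_i(\nu)=\frac{\lambda_i a_i^\theta e^{-A_i(\nu)/s}}{\sum_j\lambda_j a_j^\theta e^{-A_j(\nu)/s}}$$ and let $q_i(\nu)=\mathcal N(v_i,Q_i)$ be the adjusted target Gaussian for $(\mu_i,\nu)$ (see context). Then $\nu$ is a stationary point of $\Phi$ if and only if $$m=\sum_{i=1}^n\omega_i(\nu)v_i,\qquad \Sigma=\sum_{i=1}^n\omega_i(\nu)\left[Q_i+(v_i-m)(v_i-m)^\top\right].$$ Equivalently, the fixed points of the moment map $T$ (see context) are exactly the stationary points of $\Phi$. At every such point, with $$b_*=\mathsf Z(\nu)^{1/\theta},\qquad M_i^*=a_i^\theta b_*^{1-\theta}e^{-A_i(\nu)/s},$$ one has $$b_*=\sum_{i=1}^n\lambda_iM_i^*,\qquad \omega_i(\nu)=\frac{\lambda_iM_i^*}{b_*}.$$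
   Context: $\mathbb S_{++}^d$ is the set of real symmetric positive-definite $d\times d$ matrices; $\mathcal G_d^1=\{\mathcal N(m,\Sigma):m\in\mathbb R^d,\ \Sigma\in\mathbb S_{++}^d\}$, identified with the open set $\mathbb R^d\times\mathbb S_{++}^d$ through $(m,\Sigma)$; differentiability and stationarity are with respect to $(m,\Sigma)$. Put $s=\tau_0+\tau_1$, $\theta=\tau_0/s$. For $\mu,\nu\in\mathcal G_d^1$, $$\mathsf A(\mu,\nu)=\inf_{p,q\in\mathcal P(\mathbb R^d)}\{W_2^2(p,q)+\tau_0\mathrm{KL}(p\mid\mu)+\tau_1\mathrm{KL}(q\mid\nu)\},$$ with $\mathrm{KL}$ the relative entropy and $W_2^2(p,q)\in[0,\infty]$ the squared quadratic Wasserstein cost. It is known that this infimum has a unique minimizer $(p,q)$, that $p,q$ are nondegenerate Gaussians, and that their means and covariances, and $\mathsf A$, depend real-analytically on $(\mu,\nu)$; $q$ is called the adjusted target Gaussian for $(\mu,\nu)$. Set $A_i(\nu)=\mathsf A(\mu_i,\nu)$, $\mathsf Z(\nu)=\sum_i\lambda_i a_i^\theta e^{-A_i(\nu)/s}$, $\bar a=\sum_i\lambda_ia_i$ and $\Phi(\nu)=\tau_0(\bar a-\mathsf Z(\nu)^{1/\theta})$. (This $\Phi(\nu)$ is the infimum over $b>0$ of the weighted sum $\sum_i\lambda_i\mathsf U_{\tau_0,\tau_1}(a_i\mu_i,b\nu)$ of quadratic KL-unbalanced optimal transport costs, attained at $b=\mathsf Z(\nu)^{1/\theta}$, and $M_i^*$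 is the optimal transported mass between $a_i\mu_i$ and $b_*\nu$.) The moment map $T:\mathcal G_d^1\to\mathcal G_d^1$ is $T(\nu)=\mathcal N(m^+,\Sigma^+)$ with $m^+=\sum_i\omega_i(\nu)v_i$ and $\Sigma^+=\sum_i\omega_i(\nu)[Q_i+(v_i-m^+)(v_i-m^+)^\top]$. *)

(* Defs.v *)
From HB Require Import structures.
From mathcomp Require Import all_boot all_order all_algebra.
From mathcomp Require Import all_classical all_reals all_analysis.
From mathcomp Require Import measurable_realfun.

Set Implicit Arguments.
Unset Strict Implicit.
Unset Printing Implicit Defensive.

Import Order.TTheory GRing.Theory Num.Theory.
Import numFieldNormedType.Exports.

Local Open Scope classical_set_scope.
Local Open Scope ring_scope.

(* R^d occurs in two guises: measures live on d-tuples, which carry the product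
   (Borel) sigma-algebra, while means are column vectors and covariances are
   matrices, which carry the topology and the linear structure. *)
Notation Rtuple R d := (d.-tuple (measurableTypeR R)).

Definition col_of_tuple (R : realType) (d : nat) (x : Rtuple R d) : 'cV[R]_d :=
  \col_i (tnth x i : R).

Definition posdefmx (R : realType) (d : nat) (S : 'M[R]_d) : Prop :=
  S^T = S /\ forall u : 'cV[R]_d, u != 0 -> 0 < (u^T *m S *m u) 0 0.

(* A Gaussian N(m, Sigma) is identified with the pair (m, Sigma). *)
Notation gauss_param R d := ('cV[R]_d * 'M[R]_d)%type.

Definition nondeg_gaussian (R : realType) (d : nat) : set (gauss_param R d) :=
  [set nu | posdefmx nu.2].

Section GaussianLaw.
Context (R : realType).

Definition tuple_cons (d : nat) (z : measurableTypeR R * Rtuple R d) :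
  Rtuple R d.+1 := [tuple of z.1 :: z.2].

Lemma measurable_tuple_cons d : measurable_fun setT (@tuple_cons d).
Proof. exact: measurable_cons. Qed.

HB.instance Definition _ d :=
  isMeasurableFun.Build _ _ _ _ (@tuple_cons d) (@measurable_tuple_cons d).

Fixpoint std_gaussian (d : nat) : probability (Rtuple R d) R :=
  match d with
  | 0 => dirac ([tuple] : Rtuple R 0)
  | d'.+1 => distribution (normal_prob (0 : R) 1 \x std_gaussian d')%E
               (@tuple_cons d')
  end.

Variable d : nat.

(* On positive-definite matrices, the unique positive-definite square root. *)
Definition sqrtmx (S : 'M[R]_d) : 'M[R]_d :=
  get [set L | posdefmx L /\ L *m L = S].

Definition affine_map (nu : gauss_param R d) (z : Rtuple R d) : Rtuple R d :=
  [tuple (nu.1 + sqrtmx nu.2 *m col_of_tuple z) i 0 | i < d].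

Lemma measurable_affine_map nu : measurable_fun setT (affine_map nu).
Proof.
apply/measurable_fun_tnthP => i.
rewrite (_ : _ \o _ = fun z : Rtuple R d =>
  nu.1 i 0 + \sum_(j < d) sqrtmx nu.2 i j * tnth z j); last first.
  apply/funext => z /=; rewrite tnth_mktuple !mxE; congr (_ + _).
  by apply: eq_bigr => j _; rewrite mxE.
apply: measurable_funD => //; apply: measurable_sum => j.
by apply: measurable_funM => //; exact: measurable_tnth.
Qed.

HB.instance Definition _ nu :=
  isMeasurableFun.Build _ _ _ _ (affine_map nu) (measurable_affine_map nu).

(* N(m, Sigma) as the law of m + Sigma^(1/2) Z with Z standard Gaussian. *)
Definition gaussian (nu : gauss_param R d) : probability (Rtuple R d) R :=
  distribution (std_gaussian d) (affine_map nu).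

End GaussianLaw.

Section UnbalancedTransport.
Context (R : realType) (d : nat).
Notation P := (probability (Rtuple R d) R).
Local Open Scope charge_scope.
Local Open Scope ereal_scope.

Definition KL (p mu : P) : \bar R :=
  if `[< p `<< mu >] then
    \int[p]_x lne (('d (charge_of_finite_measure p) '/d mu) x)
  else +oo.

Definition sqdist (x y : Rtuple R d) : R :=
  (\sum_(i < d) (tnth x i - tnth y i) ^+ 2)%R.

Definition couplings (p q : P) :
    set (probability (Rtuple R d * Rtuple R d)%type R) :=
  [set pi | forall A, measurable A ->
     pi (A `*` setT) = p A /\ pi (setT `*` A) = q A].

Definition W2sq (p q : P) : \bar R :=
  ereal_inf [set \int[pi]_z (sqdist z.1 z.2)%:E | pi in couplings p q].

Variables tau0 tau1 : R.

Definition UOT_cost (mu nu : gauss_param R d) (p q : P) : \bar R :=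
  W2sq p q + tau0%:E * KL p (gaussian mu) + tau1%:E * KL q (gaussian nu).

Definition UOT (mu nu : gauss_param R d) : R :=
  fine (ereal_inf [set UOT_cost mu nu pq.1 pq.2 | pq in [set: P * P]]).

Definition UOT_minimizer (mu nu : gauss_param R d) (p q : P) : Prop :=
  forall p' q' : P, UOT_cost mu nu p q <= UOT_cost mu nu p' q'.

(* The parameters (v, Q) of the second component q = N(v, Q) of the minimizer. *)
Definition adjusted_target (mu nu : gauss_param R d) : gauss_param R d :=
  get [set r | nondeg_gaussian r /\
               exists p : P, UOT_minimizer mu nu p (gaussian r)].

End UnbalancedTransport.

(* Stationarity with respect to (m, Sigma) in R^d x Sym_d.  Precomposing with the
   linear projection X |-> (X + X^T) / 2 of the space of all matrices onto Sym_d
   makes f a function on a full matrix space without changing it on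
   symmetric matrices, so that only symmetric variations of Sigma matter. *)
Definition symmx (R : realType) (d : nat) (X : 'M[R]_d) : 'M[R]_d :=
  2^-1 *: (X + X^T).

Definition stationary_point (R : realType) (d : nat) (f : gauss_param R d -> R)
    (nu : gauss_param R d) : Prop :=
  let g := fun x : gauss_param R d => f (x.1, symmx x.2) in
  differentiable g nu /\ forall h, 'd g nu h = 0.

Section Barycenter.
Context (R : realType) (d n : nat).
Variables (tau0 tau1 : R) (lam a : 'I_n -> R) (mu : 'I_n -> gauss_param R d).
Implicit Types nu : gauss_param R d.

Notation s := (tau0 + tau1).
Notation theta := (tau0 / s).

Definition Acost (i : 'I_n) nu : R := UOT tau0 tau1 (mu i) nu.

Definition Zsum nu : R :=
  \sum_i lam i * a i `^ theta * expR (- Acost i nu / s).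

Definition Phi nu : R :=
  tau0 * (\sum_i lam i * a i - Zsum nu `^ theta^-1).

Definition omega (i : 'I_n) nu : R :=
  lam i * a i `^ theta * expR (- Acost i nu / s) /
  \sum_j lam j * a j `^ theta * expR (- Acost j nu / s).

Definition adj_mean (i : 'I_n) nu : 'cV[R]_d :=
  (adjusted_target tau0 tau1 (mu i) nu).1.

Definition adj_cov (i : 'I_n) nu : 'M[R]_d :=
  (adjusted_target tau0 tau1 (mu i) nu).2.

Definition moment_map nu : gauss_param R d :=
  let mp := \sum_i omega i nu *: adj_mean i nu in
  (mp, \sum_i omega i nu *: (adj_cov i nu +
         (adj_mean i nu - mp) *m (adj_mean i nu - mp)^T)).

Definition bstar nu : R := Zsum nu `^ theta^-1.

Definition Mstar (i : 'I_n) nu : R :=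
  a i `^ theta * bstar nu `^ (1 - theta) * expR (- Acost i nu / s).

End Barycenter.

(* Main.v *)
Require Import Defs.
From HB Require Import structures.
From mathcomp Require Import all_boot all_order all_algebra.
From mathcomp Require Import all_classical all_reals all_analysis.
From mathcomp Require Import measurable_realfun.
From mathcomp.real_closed Require Import complex.
From mathcomp Require Import spectral.
From mathcomp Require Import ring lra.

Set Implicit Arguments.
Unset Strict Implicit.
Unset Printing Implicit Defensive.

Import Order.TTheory GRing.Theory Num.Theory.
Import numFieldNormedType.Exports.

Local Open Scope classical_set_scope.
Local Open Scope ring_scope.

(* A coupling carried by the graph of an affine map and a pair of quadratic dual
   potentials are explicit optimisers of the transport problem with equal values,
   which come from a matrix Riccati equation. This makes A(mu, .) differentiable
   at nu by a sandwich. With the minimizer for nu frozen, the cost as a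
   function of nu' is a smooth majorant which touches A(mu, .) at nu and is
   tau1 KL(q | nu') up to a constant, where q is the adjusted target. Replacing
   nu by nu' in the dual potential and completing the square gives a smooth
   minorant touching at the same point. So the gradient of A(mu, .) at nu is that
   of tau1 KL(q | .), and the stationarity of Phi says that the omega-average of
   the gradients of KL(q_i | .) vanishes, which is moment matching of nu with the
   mixture of the q_i. *)

(** * Positive definite matrices *)

(** The Riccati equation says that the dual slack is a single square. If the optimal pair has
    covariances [P] and [Q], the quadratic part of [sqdist x y + tau0 * ln (gdens r0 mu x) + tau1 *
    ln (gdens r1 nu y)] has diagonal blocks 1 + (tau0 / 2)(S0^-1 - P^-1) and 1 + (tau1 / 2)(S1^-1 -
    Q^-1) and off-diagonal block -1. It is the square of y - T x in the form T^-1 when these blocks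
    are T and T^-1; with Q = T P T this leaves one equation for T. The competitors in the dual bound
    are arbitrary probability measures, possibly without moments, against which a logarithmic
    potential need not be integrable. So the potentials are eliminated pointwise under a coupling
    before anything is integrated. The majorant and the minorant come from different descriptions of
    the optimum: the first from the minimizer selected by [adjusted_target], the second from the
    explicit pair. They are linked only through their common value at nu, and contact then forces
    their gradients to agree. *)

Lemma real_symmetric_diagonalizable (R : rcfType) n (S : 'M[R]_n) : S^T = S ->
  exists P : 'M[R]_n, exists D : 'rV[R]_n, P \in unitmx /\ P *m S = diag_mx D *m P.
Proof.
move=> symS.
pose toC := real_complex R.
pose Sc := map_mx toC S.
have Scsym : Sc \is symmetricmx.
  by apply/is_hermitianmxP; rewrite expr0 scale1r map_mx_id// /Sc map_trmx symS.
have Screal : Sc \is a realmx.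
  by apply/mxOverP => i j; rewrite mxE complex_real.
have Scherm := realsym_hermsym Scsym Screal.
have /orthomx_spectralP spE := hermitian_normalmx Scherm.
have spreal := hermitian_spectral_diag_real Scherm.
have Dreal : diag_mx (spectral_diag Sc) \is a realmx.
  apply/mxOverP => i j; rewrite mxE; case: eqP => _; rewrite ?mulr1n ?mulr0n ?real0//.
  exact: (mxOverP spreal).
have sim : similar_in unitmx Sc (diag_mx (spectral_diag Sc)).
  exists (spectralmx Sc); first exact: spectral_unit.
  by apply/similarP; rewrite ?spectral_unit// {2}spE !mulmxA mulmxV ?spectral_unit// mul1mx.
(* The spectral theorem is applied over the complex numbers. Both [Sc] and its spectrum are real, so
   a real conjugating matrix exists. It is only known to be invertible, not orthogonal. *)
have [B /= /andP[Breal Bu] /(similarP Bu) BE] := real_similar sim Screal Dreal.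
have realK m p (M : 'M[R[i]]_(m, p)) : M \is a realmx -> map_mx toC (map_mx (@complex.Re R) M) = M.
  by move=> Mr; apply/matrixP => i j; rewrite !mxE; apply: RRe_real; exact: (mxOverP Mr).
exists (map_mx (@complex.Re R) B), (map_mx (@complex.Re R) (spectral_diag Sc)).
split; first by rewrite -(map_unitmx toC) realK.
apply: (map_mx_inj (f := toC)).
by rewrite !map_mxM/= map_diag_mx !realK.
Qed.

Section posdef.
Context (R : realType).

Section ring.
Variable d : nat.
Implicit Types (S A B M : 'M[R]_d) (u v : 'cV[R]_d).

Definition qf A u := (u^T *m A *m u) 0 0.

Lemma qfD A B u : qf (A + B) u = qf A u + qf B u.
Proof. by rewrite /qf mulmxDr mulmxDl mxE. Qed.

Lemma qfZ (a : R) A u : qf (a *: A) u = a * qf A u.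
Proof. by rewrite /qf -scalemxAr -scalemxAl mxE. Qed.

Lemma qfN A u : qf (- A) u = - qf A u.
Proof. by rewrite -scaleN1r qfZ mulN1r. Qed.

Lemma qf_congr M A u : qf (M^T *m A *m M) u = qf A (M *m u).
Proof. by rewrite /qf trmx_mul !mulmxA. Qed.

Lemma qf1 u : qf 1%:M u = \sum_i u i 0 ^+ 2.
Proof. by rewrite /qf mulmx1 mxE; apply: eq_bigr => i _; rewrite mxE expr2. Qed.

Lemma qf1_ge0 u : 0 <= qf 1%:M u.
Proof. by rewrite qf1; apply: sumr_ge0 => i _; exact: sqr_ge0. Qed.

Lemma qf1_eq0 u : (qf 1%:M u == 0) = (u == 0).
Proof.
rewrite qf1; apply/idP/eqP => [|->]; last by rewrite big1// => i _; rewrite mxE expr0n.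
rewrite psumr_eq0 => [/allP u0|i _]; last exact: sqr_ge0.
apply/matrixP => i j; rewrite ord1 mxE; apply/eqP.
by have := u0 i (mem_index_enum _); rewrite sqrf_eq0.
Qed.

Lemma posdef1 : posdefmx (1%:M : 'M[R]_d).
Proof. by split=> [|u u0]; rewrite ?trmx1// -/(qf _ _) lt_def qf1_ge0 qf1_eq0 u0. Qed.

Lemma posdef_qf A u : posdefmx A -> u != 0 -> 0 < qf A u.
Proof. by case=> _; exact. Qed.

Lemma posdef_qf_ge0 A u : posdefmx A -> 0 <= qf A u.
Proof.
move=> Ap; have [->|/(posdef_qf Ap)/ltW//] := eqVneq u 0.
by rewrite /qf mulmx0 mxE.
Qed.

Lemma posdef_sym A : posdefmx A -> A^T = A. Proof. by case. Qed.

Lemma posdefD A B : posdefmx A -> posdefmx B -> posdefmx (A + B).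
Proof.
move=> [sA pA] [sB pB]; split; first by rewrite linearD /= sA sB.
by move=> u u0; rewrite -/(qf _ _) qfD addr_gt0 ?pA ?pB.
Qed.

Lemma posdefZ (a : R) A : 0 < a -> posdefmx A -> posdefmx (a *: A).
Proof.
move=> a0 [sA pA]; split; first by rewrite linearZ /= sA.
by move=> u u0; rewrite -/(qf _ _) qfZ mulr_gt0// pA.
Qed.

Lemma posdef_scalar (a : R) : 0 < a -> posdefmx (a%:M : 'M[R]_d).
Proof. by move=> a0; rewrite -[a]mulr1 -scale_scalar_mx; apply: posdefZ => //; exact: posdef1. Qed.

Lemma unit_mul_neq0 M u : M \in unitmx -> u != 0 -> M *m u != 0.
Proof. by move=> Mu; apply: contra_neq => Mu0; rewrite -(mulKmx Mu u) Mu0 mulmx0. Qed.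

Lemma posdef_congr M A : M \in unitmx -> posdefmx A -> posdefmx (M^T *m A *m M).
Proof.
move=> Mu [sA pA]; split; first by rewrite !trmx_mul trmxK sA mulmxA.
by move=> u u0; rewrite -/(qf _ _) qf_congr pA// unit_mul_neq0.
Qed.

Lemma posdef_unit A : posdefmx A -> A \in unitmx.
Proof.
move=> [sA pA]; rewrite -row_free_unit -kermx_eq0; apply/rowV0P => v /sub_kermxP vA0.
apply/eqP; apply/negPn/negP => v0.
have vT0 : v^T != 0 by apply: contra_neq v0 => /(congr1 trmx); rewrite trmxK trmx0.
by have := pA _ vT0; rewrite trmxK vA0 mul0mx mxE ltxx.
Qed.

Lemma posdef_inv A : posdefmx A -> posdefmx (invmx A).
Proof.
move=> pA; have Au := posdef_unit pA.
have := posdef_congr (_ : invmx A \in unitmx) pA.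
rewrite unitmx_inv => /(_ Au).
by rewrite trmx_inv (posdef_sym pA) mulVmx// mul1mx.
Qed.

Lemma posdef_gram M : M \in unitmx -> posdefmx (M^T *m M).
Proof. by move=> Mu; rewrite -[M^T]mulmx1; apply: posdef_congr => //; exact: posdef1. Qed.

End ring.

(* The square root is [h(S)] for [h = sqrt], and it is positive definite because
   it is the square of the symmetric matrix obtained for the fourth root. *)
Lemma posdef_sqrt d (S : 'M[R]_d) : posdefmx S -> exists L, posdefmx L /\ L *m L = S.
Proof.
move=> pS; have [P [D [Pu PS]]] := real_symmetric_diagonalizable (posdef_sym pS).
have D_gt0 i : 0 < D 0 i.
  pose r := row i P.
  have rS : r *m S = D 0 i *: r by rewrite -row_mul PS; apply/rowP => j; rewrite mul_diag_mx !mxE.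
  have r0 : r^T != 0.
    apply: contraTneq Pu => /(congr1 trmx); rewrite trmxK trmx0 => r0.
    rewrite -row_free_unit; apply/negP => /row_free_inj Pinj.
    have : delta_mx 0 i *m P = 0 *m P :> 'rV_d by rewrite -rowE mul0mx.
    move=> /Pinj/matrixP/(_ 0 i); rewrite !mxE !eqxx => /eqP.
    by rewrite oner_eq0.
  have := posdef_qf pS r0; rewrite /qf trmxK rS -scalemxAl mxE.
  have := posdef_qf (posdef1 d) r0; rewrite /qf trmxK mulmx1 => rr.
  by rewrite pmulr_lgt0.
pose f (h : R -> R) := invmx P *m diag_mx (map_mx h D) *m P.
have fM h k : f h *m f k = f (fun x => h x * k x).
  rewrite /f !mulmxA mulmxK// -(mulmxA (invmx P)); congr (_ *m _ *m _).
  by apply/matrixP => i j; rewrite mul_diag_mx !mxE; have [->|_] := eqVneq i j; rewrite ?mulr1n ?mulr0n ?mulr0.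
have fS : f id = S.
  by rewrite /f map_mx_id// -mulmxA -PS mulKmx.
have fext h k : (forall i, h (D 0 i) = k (D 0 i)) -> f h = f k.
  move=> hk; congr (_ *m diag_mx _ *m _); apply/matrixP => i j.
  by rewrite !mxE ord1 hk.
(* Since [P] is merely invertible, symmetry is not immediate. Symmetry of [S] makes [K] commute with
   [diag_mx D], so [K] vanishes between distinct eigenvalues and commutes with every function of
   [D]. *)
have fT h : (f h)^T = f h.
  pose K := P *m P^T.
  have KD : diag_mx D *m K = K *m diag_mx D.
    rewrite /K mulmxA -PS -mulmxA -[in LHS](posdef_sym pS) -trmx_mul PS trmx_mul.
    by rewrite tr_diag_mx mulmxA.
  have KhD : diag_mx (map_mx h D) *m K = K *m diag_mx (map_mx h D).
    move: (K) KD => K0 KD; apply/matrixP => i j; move/matrixP: KD => /(_ i j).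
    rewrite !mul_diag_mx !mul_mx_diag !mxE => DK.
    have [->|Dij] := eqVneq (D 0 i) (D 0 j); first by rewrite mulrC.
    suff -> : K0 i j = 0 by rewrite mulr0 mul0r.
    apply/eqP; move/eqP: DK; rewrite mulrC -subr_eq0 -mulrBr mulf_eq0 subr_eq0.
    by rewrite (negbTE Dij) orbF.
  rewrite /f !trmx_mul tr_diag_mx trmx_inv.
  have PTu : P^T \in unitmx by rewrite unitmx_tr.
  rewrite (_ : _ *m _ = invmx P *m (K *m diag_mx (map_mx h D)) *m invmx P^T); last first.
    by rewrite -KhD /K !mulmxA mulmxK.
  by rewrite /K !mulmxA mulVmx// mul1mx.
have sq i : 0 <= Num.sqrt (D 0 i) by exact: sqrtr_ge0.
exists (f Num.sqrt); split; last first.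
  by rewrite fM -[RHS]fS; apply: fext => i /=; rewrite -expr2 sqr_sqrtr// ltW.
have -> : f Num.sqrt = (f (fun x => Num.sqrt (Num.sqrt x)))^T *m
                       f (fun x => Num.sqrt (Num.sqrt x)).
  by rewrite fT fM; apply: fext => i; rewrite -expr2 sqr_sqrtr.
apply: posdef_gram; rewrite !unitmx_mul unitmx_inv Pu andbT/=.
rewrite unitmxE det_diag unitfE; apply/prodf_neq0 => i _.
by rewrite mxE gt_eqF// !sqrtr_gt0.
Qed.

Lemma sqrtmxP d (S : 'M[R]_d) : posdefmx S ->
  posdefmx (sqrtmx S) /\ sqrtmx S *m sqrtmx S = S.
Proof. by move=> /posdef_sqrt[L HL]; apply: (@getPex _ [set L | posdefmx L /\ L *m L = S]); exists L. Qed.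

(** Conjugating S - c by S + c gives (S^2 - c^2)(S + c). With L the square root of S, which commutes
    with S^2, this is L (S^2 - c^2) L + c (S^2 - c^2), a sum of two positive definite matrices. *)
Lemma posdef_sqrB d (S : 'M[R]_d) (c : R) : 0 < c -> posdefmx S ->
  posdefmx (S *m S - (c ^+ 2)%:M) -> posdefmx (S - c%:M).
Proof.
move=> c0 pS pSc; have [pL LL] := sqrtmxP pS; set L := sqrtmx S in pL LL.
have u := posdef_unit (posdefD pS (posdef_scalar d c0)).
suff: posdefmx ((S + c%:M)^T *m (S - c%:M) *m (S + c%:M)).
  have iu : invmx (S + c%:M) \in unitmx by rewrite unitmx_inv.
  move=> /(posdef_congr iu); rewrite trmx_inv !mulmxA mulVmx ?unitmx_tr// mul1mx.
  by rewrite mulmxK.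
have -> : (S + c%:M)^T *m (S - c%:M) *m (S + c%:M) =
   L^T *m (S *m S - (c ^+ 2)%:M) *m L + c *: (S *m S - (c ^+ 2)%:M).
  have LS : L *m S = S *m L by rewrite -LL mulmxA.
  rewrite (posdef_sym pL) (posdef_sym (posdefD pS (posdef_scalar d c0))).
  have -> : (S + c%:M) *m (S - c%:M) = S *m S - (c ^+ 2)%:M.
    rewrite mulmxDl !mulmxDr !mulmxN -scalar_mxM mul_mx_scalar mul_scalar_mx -expr2.
    by rewrite addrA addrNK.
  rewrite (mulmxDr _ S) mul_mx_scalar; congr (_ + _).
  have -> : L *m (S *m S - (c ^+ 2)%:M) = (S *m S - (c ^+ 2)%:M) *m L.
    rewrite mulmxBr mulmxBl scalar_mxC; congr (_ - _).
    by rewrite mulmxA LS -mulmxA LS mulmxA.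
  by rewrite -mulmxA LL.
apply: posdefD; last exact: posdefZ.
by apply: posdef_congr => //; exact: posdef_unit.
Qed.

(* Conjugation by B^(1/2) reduces the equation to
   [X ^ 2 - (be - al) X = C] with [X = B^(1/2) T B^(1/2)] and
   [C = B^(1/2) A B^(1/2)]. *)
Lemma posdef_riccati d (A B : 'M[R]_d) (al be : R) : 0 < al -> 0 < be ->
    posdefmx (A - al%:M) -> posdefmx (B - be%:M) ->
  exists T, [/\ posdefmx T, posdefmx (A - al *: T) &
    A - al *: T = T *m B *m T - be *: T].
Proof.
move=> al0 be0 pA pB.
have pB' : posdefmx B by rewrite -[B](subrK be%:M); apply: posdefD => //; exact: posdef_scalar.
have [pL LL] := sqrtmxP pB'; set L := sqrtmx B in pL LL.
have Lu := posdef_unit pL; have symL := posdef_sym pL.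
(* With [g] as below, k^2 - al be = g^2, so S^2 = C + g^2 completes the square in the reduced
   equation. Moreover X - be = S - k, so the bound C > al be, that is S^2 > k^2, becomes X > be. *)
pose k := (al + be) / 2; have k0 : 0 < k by rewrite divr_gt0// addr_gt0.
pose C := L *m A *m L.
have pC : posdefmx (C - (al * be)%:M).
  have -> : C - (al * be)%:M = L^T *m (A - al%:M) *m L + al *: (B - be%:M).
    rewrite symL mulmxBr mulmxBl scalerBr scale_scalar_mx addrA; congr (_ - _).
    by rewrite mul_mx_scalar -scalemxAl LL subrK.
  by apply: posdefD; [exact: posdef_congr|exact: posdefZ].
have k20 : 0 < k ^+ 2 by rewrite exprn_gt0.
have [pS SS] := sqrtmxP (posdefD pC (posdef_scalar d k20)); set S := sqrtmx _ in pS SS.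
have pSk : posdefmx (S - k%:M) by apply: posdef_sqrB => //; rewrite SS addrK.
pose g := (be - al) / 2.
pose X := S + g%:M.
have Xbe : X - be%:M = S - k%:M.
  rewrite /X -addrA -rmorphB/=; congr (_ + _); rewrite -rmorphN/=; congr (_%:M).
  by rewrite /g /k; field.
have pX : posdefmx X.
  by rewrite -[X](subrK be%:M) Xbe; apply: posdefD => //; exact: posdef_scalar.
have XX : X *m X - (be - al) *: X = C.
  rewrite /X mulmxDr !mulmxDl SS !mul_scalar_mx mul_mx_scalar scale_scalar_mx.
  move: (C) (S) => C0 S0; apply/matrixP => i j; rewrite !mxE.
  by case: (i == j); rewrite ?mulr1n ?mulr0n /k /g; field.
have Lsym : (invmx L)^T = invmx L by rewrite trmx_inv symL.
have iLu : invmx L \in unitmx by rewrite unitmx_inv.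
pose T := invmx L *m X *m invmx L.
have TBT : T *m B *m T = invmx L *m (X *m X) *m invmx L.
  by rewrite /T -LL !mulmxA mulmxKV// mulmxK.
have T_eq : A - al *: T = T *m B *m T - be *: T.
  have AE : A = invmx L *m (X *m X - (be - al) *: X) *m invmx L.
    by rewrite XX /C !mulmxA mulVmx// mul1mx mulmxK.
  rewrite {1}AE TBT mulmxBr mulmxBl -scalemxAr -scalemxAl -/T scalerBl opprB.
  by rewrite addrA addrAC addrK.
have [pV VV] := sqrtmxP pX; set V := sqrtmx X in pV VV.
exists T; split=> //; first by rewrite /T -{1}Lsym; exact: posdef_congr.
(* By the equation it suffices to treat its right side, which is congruent to X^(1/2) (X - be)
   X^(1/2); positivity is the bound X > be. *)
rewrite T_eq TBT.
have -> : invmx L *m (X *m X) *m invmx L - be *: T =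
    (invmx L)^T *m (V^T *m (X - be%:M) *m V) *m invmx L.
  rewrite Lsym /T scalemxAl scalemxAr -mulmxBl -mulmxBr; congr (_ *m _ *m _).
  rewrite (posdef_sym pV) mulmxBr mulmxBl mul_mx_scalar -scalemxAl VV; congr (_ - _).
  by rewrite -{2 3}VV -VV !mulmxA.
apply: posdef_congr => //; apply: posdef_congr; first exact: posdef_unit.
by rewrite Xbe.
Qed.

End posdef.

(** * Gaussian measures and affine maps *)

Section density.
Context d (T : measurableType d) (R : realType).
Local Open Scope ereal_scope.

Lemma density_dominates (nu : {measure set T -> \bar R})
    (mu : {measure set T -> \bar R}) (rho : T -> \bar R) :
    (forall A, measurable A -> nu A = \int[mu]_(x in A) rho x) ->
    measurable_fun setT rho -> nu `<< mu.
Proof.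
move=> nuE mrho; apply/null_content_dominatesP => A mA A0; rewrite nuE//.
by apply: null_set_integral => //; exact: measurable_funTS.
Qed.

(** [rho] and the Radon-Nikodym derivative have the same integral over every measurable set, hence
    agree almost everywhere; the formula is then the change of variables for the latter. *)
Lemma ge0_integral_density (nu : {finite_measure set T -> \bar R})
    (mu : {sigma_finite_measure set T -> \bar R}) (rho f : T -> \bar R) :
    (forall A, measurable A -> nu A = \int[mu]_(x in A) rho x) ->
    measurable_fun setT rho -> (forall x, 0 <= rho x) ->
    measurable_fun setT f -> (forall x, 0 <= f x) ->
  \int[nu]_x f x = \int[mu]_x (f x * rho x).
Proof.
move=> nuE mrho rho0 mf f0.
have numu := density_dominates nuE mrho.
have mRN := measurable_int _ (Radon_Nikodym_SigmaFinite.f_integrable numu).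
rewrite -(Radon_Nikodym_SigmaFinite.change_of_variables numu)//.
apply: ae_eq_integral => //; [exact: emeasurable_funM|exact: emeasurable_funM|].
apply: ae_eqe_mul2l; apply: integral_ae_eq => //.
- exact: Radon_Nikodym_SigmaFinite.f_integrable.
- by move=> A _ mA; rewrite -nuE// -Radon_Nikodym_SigmaFinite.f_integral.
Qed.

End density.

(** * Affine changes of variable on the line *)

Section lebesgue_affine.
Context (R : realType).
Local Notation mu := (@lebesgue_measure R).
Local Open Scope ereal_scope.

Definition affine1 (a b : R) : measurableTypeR R -> measurableTypeR R := fun x => (a * x + b)%R.

Lemma measurable_affine1 a b : measurable_fun setT (affine1 a b).
Proof. by apply: measurable_funD => //; exact: measurable_funM. Qed.

Local Notation push a b :=
  (measure_function_pushforward__canonical__measure_function_Measure mu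
     (measurable_affine1 a b)).

(** Both sides are measures that agree on half-open intervals, and this determines Lebesgue
    measure. *)
Let lebesgue_affine_gt0 (a b : R) (A : set R) (a0 : (0 < a)%R) : measurable A ->
  mu A = a%:E * pushforward mu (affine1 a b) A.
Proof.
move=> mA; have -> : a = (NngNum (ltW a0))%:num by [].
apply: (@lebesgue_measure_unique R (mscale (NngNum (ltW a0)) (push a b))) => //= _ [[u v]] _ <-.
rewrite /mscale/= /pushforward.
have -> : affine1 a b @^-1` `]u, v] = `]((u - b) / a)%R, ((v - b) / a)%R]%classic.
  apply/seteqP; split => x /=; rewrite !in_itv/= /affine1 ltr_pdivrMr// ler_pdivlMr//;
  by rewrite mulrC ltrBlDr lerBrDr.
rewrite !lebesgue_measure_itv/= !lte_fin ltr_pM2r ?invr_gt0// ltrD2r.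
case: ifP => _; last by rewrite mule0.
by rewrite -!EFinD -EFinM; congr _%:E; field; exact: lt0r_neq0.
Qed.

Lemma ge0_integral_lebesgue_affine (a b : R) (f : R -> \bar R) : a != 0%R ->
    measurable_fun setT f -> (forall x, 0 <= f x) ->
  \int[mu]_x f x = `|a|%:E * \int[mu]_x f (a * x + b)%R.
Proof.
move=> an0 mf f0; wlog a0 : a f an0 mf f0 / (0 < a)%R => [wlg|].
  have [|aN] := ltP 0%R a; first exact: wlg.
  have Na0 : (0 < - a)%R by rewrite oppr_gt0 lt_neqAle an0.
  rewrite (wlg (- a)%R) ?oppr_eq0// normrN; congr (_ * _).
  have mg : measurable_fun [set: R] (fun x => f (- a * x + b)%R).
    exact: (measurableT_comp mf (measurable_affine1 (- a) b)).
  under [RHS]eq_integral do rewrite -[in (a * _)%R](opprK a) mulNr -mulrN.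
  rewrite -(@ge0_integral_pushforward _ _ _ _ _ (-%R : measurableTypeR R -> measurableTypeR R)
     _ mu setT (fun x => f (- a * x + b)%R))//.
  by apply: eq_measure_integral => //= A mA _; rewrite lebesgue_measureN.
rewrite (eq_measure_integral (mscale (NngNum (ltW a0)) (push a b))); last first.
  by move=> A mA _; exact: (lebesgue_affine_gt0 b a0 mA).
rewrite ge0_integral_mscale//= ger0_norm ?ltW//; congr (_ * _).
exact: (ge0_integral_pushforward (measurable_affine1 a b) mu measurableT mf (fun x _ => f0 x)).
Qed.

(** The weight cancels the exponential in the normal density and leaves only its normalising
    constant. This is what lets the standard Gaussian stand in for Lebesgue measure. *)
Lemma ge0_integral_normal_prob (f : R -> \bar R) :
    measurable_fun setT f -> (forall x, 0 <= f x) ->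
  \int[normal_prob 0 1]_x (f x * (expR (x ^+ 2 / 2))%:E) =
  (normal_peak 1)%:E * \int[mu]_x f x.
Proof.
move=> mf f0.
have mw : measurable_fun [set: R] (fun x : R => (expR (x ^+ 2 / 2))%:E).
  apply/measurable_EFinP/measurableT_comp => //.
  by apply: measurable_funM => //; exact: measurable_funX.
rewrite (@ge0_integral_density _ _ _ _ mu (fun x => (normal_pdf 0 1 x)%:E))//.
- rewrite -ge0_integralZl//; last by rewrite lee_fin normal_peak_ge0.
  apply: eq_integral => x _; rewrite normal_pdfE ?oner_eq0// EFinM muleCA -!muleA.
  congr (_ * _); rewrite -[RHS]mule1; congr (_ * _).
  rewrite -EFinM /normal_fun -expRD subr0 expr1n.
  by rewrite -expR0; congr (expR _)%:E; field.
- by apply/measurable_EFinP; exact: measurable_normal_pdf.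
- by move=> x; rewrite lee_fin normal_pdf_ge0.
- exact: emeasurable_funM.
- by move=> x; rewrite mule_ge0// lee_fin expR_ge0.
Qed.

End lebesgue_affine.

(** * Lebesgue integration on R^d through the standard Gaussian *)

Section volume.
Context (R : realType).

Definition tuple_of_col d (y : 'cV[R]_d) : Rtuple R d := [tuple y i 0 | i < d].

Lemma col_of_tupleK d : cancel (@col_of_tuple R d) (@tuple_of_col d).
Proof. by move=> x; apply: eq_from_tnth => i; rewrite tnth_mktuple mxE. Qed.

Lemma tuple_of_colK d : cancel (@tuple_of_col d) (@col_of_tuple R d).
Proof. by move=> y; apply/colP => i; rewrite mxE tnth_mktuple. Qed.

Lemma tuple_of_col_mx d (z : R) (y : 'cV[R]_d) :
  tuple_of_col (col_mx (z%:M : 'cV_1) y : 'cV_(1 + d)) = tuple_cons (z, tuple_of_col y).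
Proof.
apply: (can_inj (@col_of_tupleK _)); rewrite tuple_of_colK.
apply/matrixP => i j; rewrite ord1 [LHS]mxE [RHS]mxE.
case: splitP => k ik.
  rewrite [LHS]mxE ord1 mulr1n (_ : i = ord0) ?tnth0//; apply: val_inj.
  by rewrite /= ik ord1.
have -> : i = lift ord0 k by apply: val_inj; rewrite /= ik.
by rewrite tnthS tnth_mktuple.
Qed.

Lemma col_of_tuple_cons d (z : R) (x : Rtuple R d) :
  col_of_tuple (tuple_cons (z, x)) = col_mx (z%:M : 'cV_1) (col_of_tuple x).
Proof. by rewrite -[RHS]tuple_of_colK tuple_of_col_mx col_of_tupleK. Qed.

(** In contrast to [affine_map], the linear part is an arbitrary matrix: elimination factors and
    transport maps are not square roots of a covariance. *)
Definition aff d (m : 'cV[R]_d) (L : 'M[R]_d) (x : Rtuple R d) : Rtuple R d :=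
  tuple_of_col (m + L *m col_of_tuple x)%R.

Lemma measurable_coord d i : measurable_fun setT (fun x : Rtuple R d => col_of_tuple x i 0).
Proof. by under eq_fun do rewrite mxE; exact: measurable_tnth. Qed.

Lemma measurable_aff d m L : measurable_fun setT (@aff d m L).
Proof.
apply/measurable_fun_tnthP => i; rewrite /comp.
under eq_fun do rewrite tnth_mktuple 2!mxE.
apply: measurable_funD => //; apply: measurable_sum => j.
by apply: measurable_funM => //; exact: measurable_coord.
Qed.

Lemma aff_comp d m1 L1 m2 L2 (x : Rtuple R d) :
  aff m1 L1 (aff m2 L2 x) = aff (m1 + L1 *m m2)%R (L1 *m L2)%R x.
Proof. by rewrite /aff tuple_of_colK mulmxDr addrA mulmxA. Qed.

Definition sqnorm d (x : Rtuple R d) : R := qf 1%:M (col_of_tuple x).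

Lemma sqnormE d (x : Rtuple R d) : sqnorm x = (\sum_i tnth x i ^+ 2)%R.
Proof. by rewrite /sqnorm qf1; apply: eq_bigr => i _; rewrite mxE. Qed.

Lemma measurable_sqnorm d : measurable_fun setT (@sqnorm d).
Proof.
rewrite (funext (@sqnormE d)).
by apply: measurable_sum => i; apply: measurable_funX; exact: measurable_tnth.
Qed.

Lemma sqnorm_cons d z (x : Rtuple R d) : sqnorm (tuple_cons (z, x)) = (z ^+ 2 + sqnorm x)%R.
Proof.
rewrite !sqnormE big_ord_recl tnth0; congr (_ + _)%R.
by apply: eq_bigr => i _; rewrite tnthS.
Qed.

Local Open Scope ereal_scope.

Let wgt d (x : Rtuple R d) := (expR (sqnorm x / 2))%:E.

Let measurable_wgt d : measurable_fun setT (@wgt d).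
Proof.
apply/measurable_EFinP/measurableT_comp => //.
by apply: measurable_funM => //; exact: measurable_sqnorm.
Qed.

Let wgt_ge0 d x : 0 <= @wgt d x. Proof. by rewrite lee_fin expR_ge0. Qed.

(* Up to the constant factor [(2 pi) ^ (d / 2)], the Lebesgue integral on [R^d]. *)
Definition vol d (f : Rtuple R d -> \bar R) : \bar R :=
  \int[std_gaussian R d]_x (f x * (expR (sqnorm x / 2))%:E).

Local Notation gauss1 := (normal_prob (0%R : R) 1%R).
Local Notation w1 z := (expR ((z : R) ^+ 2 / 2))%:E.

Let measurable_w1 : measurable_fun setT (fun z : R => w1 z).
Proof.
apply/measurable_EFinP/measurableT_comp => //.
by apply: measurable_funM => //; exact: measurable_funX.
Qed.

Section cons.
Variables (d : nat) (f : Rtuple R d.+1 -> \bar R).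
Hypotheses (mf : measurable_fun setT f) (f0 : forall x, 0 <= f x).

Let F (p : measurableTypeR R * Rtuple R d) := f (tuple_cons p) * wgt (tuple_cons p).

Let mfw : measurable_fun setT (fun x => f x * wgt x).
Proof. exact: (emeasurable_funM mf (@measurable_wgt _)). Qed.

Let mF : measurable_fun setT F.
Proof.
apply: (measurableT_comp (f := fun x => f x * wgt x)); last exact: measurable_tuple_cons.
exact: mfw.
Qed.

Let F0 p : 0 <= F p. Proof. by rewrite mule_ge0. Qed.

Let FE z x : F (z, x) = f (tuple_cons (z, x)) * wgt x * w1 z.
Proof.
rewrite /F /wgt sqnorm_cons mulrDl expRD EFinM muleA.
by rewrite -!muleA; congr (_ * _); rewrite muleC.
Qed.

(** Tonelli with the first coordinate outermost, suited to maps that fix that coordinate;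
    [vol_cons_swap] is the other order, suited to maps that change only that coordinate. *)
Lemma vol_cons : vol f = \int[gauss1]_z (vol (fun x => f (tuple_cons (z, x))) * w1 z).
Proof.
rewrite /vol [LHS](ge0_integral_distribution (tuple_cons (d:=d)) (f := fun x => f x * wgt x)) //; last first.
  by move=> x; rewrite mule_ge0.
rewrite [LHS](fubini_tonelli1 _ mF F0); apply: eq_integral => z _.
rewrite -ge0_integralZr//.
- by apply: eq_integral => x _; rewrite FE.
- apply: (emeasurable_funM _ (@measurable_wgt d)).
  apply: measurableT_comp => //; apply: measurableT_comp (@measurable_tuple_cons R d) _.
  exact: measurable_pair1.
- by move=> x _; rewrite mule_ge0// wgt_ge0.
Qed.

Lemma vol_cons_swap : vol f =
  \int[std_gaussian R d]_x ((\int[gauss1]_z (f (tuple_cons (z, x)) * w1 z)) * wgt x).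
Proof.
rewrite /vol [LHS](ge0_integral_distribution (tuple_cons (d:=d)) (f := fun x => f x * wgt x)) //; last first.
  by move=> x; rewrite mule_ge0.
rewrite [LHS](fubini_tonelli2 _ mF F0); apply: eq_integral => x _.
rewrite -ge0_integralZr//.
- by apply: eq_integral => z _; rewrite FE muleAC.
- apply: (emeasurable_funM _ measurable_w1).
  apply: measurableT_comp => //; apply: measurableT_comp (@measurable_tuple_cons R d) _.
  exact: measurable_pair2.
- by move=> z _; rewrite mule_ge0// lee_fin expR_ge0.
Qed.

Lemma measurable_consl z : measurable_fun setT (fun x : Rtuple R d => f (tuple_cons (z, x))).
Proof.
apply: measurableT_comp => //; apply: measurableT_comp (@measurable_tuple_cons R d) _.
exact: measurable_pair1.
Qed.

Lemma measurable_consr x :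
  measurable_fun setT (fun z : measurableTypeR R => f (tuple_cons (z, x))).
Proof.
apply: measurableT_comp => //; apply: measurableT_comp (@measurable_tuple_cons R d) _.
exact: measurable_pair2.
Qed.

Lemma measurable_vol_cons :
  measurable_fun setT (fun z : measurableTypeR R => vol (fun x => f (tuple_cons (z, x)))).
Proof.
pose H (p : measurableTypeR R * Rtuple R d) := f (tuple_cons p) * wgt p.2.
have mH : measurable_fun setT H.
  apply: emeasurable_funM; last exact: (measurableT_comp (@measurable_wgt d) measurable_snd).
  exact: measurableT_comp mf (@measurable_tuple_cons R d).
by apply: (measurable_fun_fubini_tonelli_F _ mH) => p; rewrite mule_ge0// wgt_ge0.
Qed.

Lemma measurable_gauss1_cons :
  measurable_fun setT (fun x => \int[gauss1]_z (f (tuple_cons (z, x)) * w1 z)).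
Proof.
pose H (p : measurableTypeR R * Rtuple R d) := f (tuple_cons p) * w1 p.1.
have mH : measurable_fun setT H.
  apply: emeasurable_funM; last exact: (measurableT_comp measurable_w1 measurable_fst).
  exact: measurableT_comp mf (@measurable_tuple_cons R d).
by apply: (measurable_fun_fubini_tonelli_G _ mH) => p; rewrite mule_ge0// lee_fin expR_ge0.
Qed.

End cons.

Lemma vol_ge0 d (f : Rtuple R d -> \bar R) : (forall x, 0 <= f x) -> 0 <= vol f.
Proof. by move=> f0; apply: integral_ge0 => x _; rewrite mule_ge0// lee_fin expR_ge0. Qed.


Lemma gauss1_affine (a b : R) (f : R -> \bar R) : a != 0%R ->
    measurable_fun setT f -> (forall x, 0 <= f x) ->
  \int[gauss1]_z (f (a * z + b)%R * w1 z) = (`|a|^-1)%:E * \int[gauss1]_z (f z * w1 z).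
Proof.
move=> a0 mf f0.
have maff : measurable_fun [set: R] (fun z : R => f (a * z + b)%R).
  by apply: measurableT_comp => //; apply: measurable_funD => //; exact: measurable_funM.
rewrite (ge0_integral_normal_prob maff)// (ge0_integral_normal_prob mf)//.
rewrite [in RHS](ge0_integral_lebesgue_affine b a0 mf f0) muleCA; congr (_ * _).
by rewrite muleA -EFinM mulVf ?normr_eq0// mul1e.
Qed.


End volume.

Section volume_affine.
Context (R : realType).
Local Open Scope ereal_scope.
Local Notation gauss1 := (normal_prob (0%R : R) 1%R).
Local Notation w1 z := (expR ((z : R) ^+ 2 / 2))%:E.

Lemma measurable_comp_aff d (f : Rtuple R d -> \bar R) m L :
  measurable_fun setT f -> measurable_fun setT (f \o aff m L).
Proof. by move=> mf; exact: (measurableT_comp mf (measurable_aff m L)). Qed.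

Let measurable_w1 : measurable_fun setT (fun z : R => w1 z).
Proof.
apply/measurable_EFinP/measurableT_comp => //.
by apply: measurable_funM => //; exact: measurable_funX.
Qed.

(** The change of variables formula as a predicate of the affine map, so that it can be multiplied
    along a factorisation of the matrix. *)
Let ok d (m : 'cV[R]_d) (L : 'M[R]_d) := forall f : Rtuple R d -> \bar R,
  measurable_fun setT f -> (forall x, 0 <= f x) ->
  vol (f \o aff m L) = (`|\det L|^-1)%:E * vol f.

Let ok_comp d (m1 m2 : 'cV[R]_d) (L1 L2 : 'M[R]_d) : ok m1 L1 -> ok m2 L2 ->
  ok (m1 + L1 *m m2)%R (L1 *m L2)%R.
Proof.
move=> ok1 ok2 f mf f0.
rewrite (_ : f \o _ = (f \o aff m1 L1) \o aff m2 L2); last first.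
  by apply/funext => x /=; rewrite aff_comp.
rewrite ok2//=; last exact: measurable_comp_aff.
by rewrite [vol _]ok1// muleA -EFinM det_mulmx normrM invfM mulrC.
Qed.


Let aff_cons d m0 (m : 'cV[R]_d) a b c (D : 'M[R]_d) z x :
  @aff R d.+1 (col_mx m0 m : 'cV_(1 + d)) (block_mx a b c D : 'M[R]_(1 + d))
    (tuple_cons (z, x)) =
  @tuple_of_col R d.+1 (col_mx (m0 + (a *m z%:M + b *m col_of_tuple x))
                               (m + (c *m z%:M + D *m col_of_tuple x)) : 'cV_(1 + d)).
Proof.
rewrite /aff col_of_tuple_cons; congr tuple_of_col.
rewrite -[LHS]/((col_mx m0 m : 'cV[R]_(1 + d)) +
  (block_mx a b c D : 'M[R]_(1 + d)) *m col_mx z%:M (col_of_tuple x))%R.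
by rewrite mul_block_col add_col_mx.
Qed.

(** For a fixed first coordinate [z] the other coordinates undergo an affine map with linear part
    [D] and a translation depending on [z]; this is why the hypothesis ranges over all
    translations. *)
Let ok_lower d (c m : 'cV[R]_d) (D : 'M[R]_d) : (forall c, ok c D) ->
  @ok d.+1 (col_mx 0 m : 'cV_(1 + d)) (block_mx 1%:M 0 c D : 'M[R]_(1 + d)).
Proof.
move=> okD f mf f0.
set A := aff _ _.
have ma : measurable_fun setT (f \o A) by exact: measurable_comp_aff.
rewrite (vol_cons ma)//= (vol_cons mf)//.
have affE z x : A (tuple_cons (z, x)) = tuple_cons (z, aff (m + c *m z%:M)%R D x).
  rewrite /A aff_cons -tuple_of_col_mx.
  by rewrite mul1mx mul0mx addr0 add0r addrA.
rewrite (det_lblock _ c D) det1 mul1r -ge0_integralZl//.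
- apply: eq_integral => z _ /=; rewrite muleA; congr (_ * _).
  rewrite -[RHS](okD (m + c *m z%:M)%R)//; last exact: measurable_consl.
  by congr vol; apply/funext => x /=; rewrite affE.
- by apply: (emeasurable_funM (measurable_vol_cons mf f0)); exact: measurable_w1.
- by move=> z _; rewrite mule_ge0 ?vol_ge0// lee_fin expR_ge0.
Qed.

(** For fixed remaining coordinates only the first one moves, by a scalar affine map of slope [a],
    and [gauss1_affine] applies inside the integral. *)
Let ok_upper d (a b0 : R) (b : 'rV[R]_d) : a != 0%R ->
  @ok d.+1 (col_mx b0%:M 0 : 'cV_(1 + d)) (block_mx a%:M b 0 1%:M : 'M[R]_(1 + d)).
Proof.
move=> a0 f mf f0.
set A := aff _ _.
have ma : measurable_fun setT (f \o A) by exact: measurable_comp_aff.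
rewrite (vol_cons_swap ma)//= (vol_cons_swap mf)//.
have affE z x : A (tuple_cons (z, x)) =
    tuple_cons ((a * z + (b0 + (b *m col_of_tuple x) 0%R 0%R))%R, x).
  rewrite /A aff_cons -[x in RHS]col_of_tupleK -tuple_of_col_mx.
  rewrite mul1mx mul0mx !add0r col_of_tupleK.
  suff -> : (b0%:M + (a%:M *m z%:M + b *m col_of_tuple x))%R =
      (a * z + (b0 + (b *m col_of_tuple x) 0%R 0%R))%:M :> 'cV[R]_1 by [].
  rewrite -scalar_mxM [(b *m _)%R in LHS]mx11_scalar -!rmorphD/=; congr (_%:M)%R.
  by rewrite addrCA.
rewrite (det_ublock _ b) det1 mulr1 det_scalar expr1 -ge0_integralZl//.
- apply: eq_integral => x _ /=; rewrite muleA; congr (_ * _).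
  under eq_integral do rewrite affE.
  rewrite (gauss1_affine _ (f := fun z => f (tuple_cons (z, x))))//.
  exact: measurable_consr.
- apply: (emeasurable_funM (measurable_gauss1_cons mf f0)).
  by apply: (measurableT_comp (f := fun t : R => (expR t)%:E)); [exact/measurable_EFinP|
     apply: measurable_funM => //; exact: measurable_sqnorm].
- move=> x _; rewrite mule_ge0 ?lee_fin ?expR_ge0//; apply: integral_ge0 => z _.
  by rewrite mule_ge0// lee_fin expR_ge0.
Qed.

Local Open Scope ring_scope.
Let usubmx00 d (m : 'cV[R]_(1 + d)) : usubmx m = ((m : 'cV[R]_d.+1) 0 0)%:M.
Proof.
apply/matrixP => i j; rewrite !ord1 !mxE mulr1n.
by have -> : @lshift 1 d 0 = (ord0 : 'I_d.+1) :> 'I_d.+1 by exact: val_inj.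
Qed.

Let ulsubmx00 d (A : 'M[R]_(1 + d)) : ulsubmx A = ((A : 'M[R]_d.+1) 0 0)%:M.
Proof.
apply/matrixP => i j; rewrite !ord1 !mxE mulr1n.
by have -> : @lshift 1 d 0 = (ord0 : 'I_d.+1) :> 'I_d.+1 by exact: val_inj.
Qed.

Local Open Scope ereal_scope.

(* Elimination with respect to the top left entry, after making it nonzero. *)
Lemma vol_aff d (m : 'cV[R]_d) (L : 'M[R]_d) (f : Rtuple R d -> \bar R) :
    L \in unitmx -> measurable_fun setT f -> (forall x, 0 <= f x) ->
  vol (f \o aff m L) = (`|\det L|^-1)%:E * vol f.
Proof.
move=> Lu; move: f; rewrite -/(ok m L).
elim: d m L Lu => [|d IH] m L Lu.
  move=> f mf f0; rewrite det_mx00 normr1 invr1 mul1e; congr vol.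
  by apply/funext => x /=; congr f; rewrite [RHS]tuple0 [LHS]tuple0.
have okl (c m' : 'cV[R]_d) (D : 'M[R]_d) : D \in unitmx ->
    @ok d.+1 (col_mx 0 m' : 'cV_(1 + d)) (block_mx 1%:M 0 c D : 'M[R]_(1 + d)).
  by move=> Du; apply: ok_lower => c'; exact: IH.
suff ok0 (A : 'M[R]_(1 + d)) : A \in unitmx -> @ok d.+1 0%R A.
  have -> : m = ((col_mx 0 (dsubmx (m : 'cV_(1 + d))) : 'cV_(1 + d)) +
      1%:M *m ((col_mx (m 0 0)%:M 0 : 'cV_(1 + d)) + 1%:M *m 0))%R.
    rewrite mul1mx mulmx0 addr0 add_col_mx add0r addr0 -[LHS](@vsubmxK _ 1 d).
    suff -> : usubmx (m : 'cV_(1 + d)) = (m 0%R 0%R)%:M by [].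
    by rewrite -usubmx00.
  have -> : L = (1%:M *m (1%:M *m L))%R by rewrite !mul1mx.
  apply: ok_comp; first by rewrite (scalar_mx_block 1 d); apply: okl; exact: unitmx1.
  apply: ok_comp; last exact: ok0.
  by rewrite (scalar_mx_block 1 d); exact: ok_upper (oner_neq0 _).
(* Block elimination with pivot [a]: the lower factor carries the Schur complement D - a^-1 c b,
   which inherits invertibility from [B], so the induction hypothesis applies to it. *)
have ok_nz (B : 'M[R]_(1 + d)) : B \in unitmx -> B 0%R 0%R != 0%R -> @ok d.+1 0%R B.
  move=> Bu; set a := B 0%R 0%R => a0.
  pose b := ursubmx B; pose c := dlsubmx B; pose D := drsubmx B.
  have BE : B = (block_mx 1%:M 0 (a^-1 *: c) (D - a^-1 *: (c *m b)) *m
                 block_mx a%:M b 0 1%:M)%R.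
    rewrite mulmx_block !mul1mx !mul0mx !mulmx0 !mulmx1 !addr0.
    rewrite mul_mx_scalar scalerA mulfV// scale1r -scalemxAl addrC subrK.
    rewrite -[LHS]submxK; suff -> : ulsubmx B = a%:M by [].
    by rewrite ulsubmx00.
  have Du : (D - a^-1 *: (c *m b))%R \in unitmx.
    move: Bu; rewrite BE unitmx_mul => /andP[+ _].
    by rewrite !unitmxE det_lblock det1 mul1r.
  have := ok_comp (okl (a^-1 *: c)%R 0%R _ Du) (@ok_upper d a 0%R b a0).
  by rewrite -BE !raddf0 !col_mx0 mulmx0 addr0.
move=> Au; have [A0|] := eqVneq (A 0%R 0%R) 0%R; last exact: ok_nz.
pose c := dlsubmx A.
have c0 : c != 0%R.
  apply: contraTneq Au => c0; rewrite unitmxE -(submxK A) -/c c0.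
  by rewrite ulsubmx00 A0 det_ublock det_scalar expr1 mul0r unitr0.
(* [U 1] adds the rows below, weighted by c^T, to the first row, so the zero corner becomes c^T c >
   0; here c is nonzero because [A] is invertible. [U (-1)] undoes this and is itself covered by
   [ok_upper]. *)
pose U (s : R) := block_mx 1%:M (s *: c^T) 0 1%:M : 'M[R]_(1 + d).
have UU : (U (-1) *m (U 1 *m A))%R = A.
  rewrite mulmxA /U mulmx_block !mul1mx !mul0mx !mulmx0 !mulmx1 !addr0 add0r.
  by rewrite scaleN1r scale1r subrr -scalar_mx_block mul1mx.
have Uu s : U s \in unitmx by rewrite unitmxE det_ublock !det1 mul1r unitr1.
suff okU : @ok d.+1 0%R (U (-1)%R).
  rewrite -UU; have -> : 0%R = (0 + U (-1) *m 0)%R :> 'cV[R]_(1 + d) by rewrite mulmx0 addr0.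
  apply: ok_comp okU _.
  apply: ok_nz; first by rewrite unitmx_mul Uu.
  have cc : (0 < (c^T *m c) 0 0)%R by have := posdef_qf (posdef1 _ _) c0; rewrite /qf mulmx1.
  suff : ulsubmx (U 1 *m A)%R = (c^T *m c)%R.
    by rewrite ulsubmx00 => /matrixP/(_ 0 0)%R; rewrite mxE mulr1n => ->; rewrite gt_eqF.
  rewrite -[A in LHS]submxK /U scale1r mulmx_block block_mxKul mul1mx ulsubmx00 A0.
  by rewrite raddf0 add0r.
have := @ok_upper d 1%R 0%R (-1 *: c^T)%R (oner_neq0 _).
by rewrite raddf0 col_mx0.
Qed.

End volume_affine.

Lemma invmx_mul (R : comUnitRingType) n (A B : 'M[R]_n) : A \in unitmx -> B \in unitmx ->
  invmx (A *m B) = invmx B *m invmx A.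
Proof.
move=> Au Bu; have ABu : A *m B \in unitmx by rewrite unitmx_mul Au.
by rewrite -[RHS](mulmxK ABu) !mulmxA mulmxKV// mulVmx// mul1mx.
Qed.

(** * Gaussian densities and second moments *)

Section gaussian_density.
Context (R : realType) (d : nat).
Implicit Types (nu r : gauss_param R d) (A L T : 'M[R]_d) (m u v : 'cV[R]_d)
  (x z : Rtuple R d).

Lemma qfE A u : qf A u = \sum_i \sum_j A i j * (u i 0 * u j 0).
Proof.
rewrite /qf mxE exchange_big/=; apply: eq_bigr => j _.
by rewrite mxE big_distrl/=; apply: eq_bigr => i _; rewrite mxE; ring.
Qed.

Lemma measurable_qf A m :
  measurable_fun setT (fun x : Rtuple R d => qf A (col_of_tuple x - m)).
Proof.
have mc i : measurable_fun setT (fun x : Rtuple R d => (col_of_tuple x - m) i 0).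
  under eq_fun do rewrite mxE [X in _ + X]mxE.
  by apply: measurable_funB => //; exact: measurable_coord.
under eq_fun do rewrite qfE.
by do 2!(apply: measurable_sum => ?); apply: measurable_funM => //; apply: measurable_funM.
Qed.

(* Minus the log-density of [N(m, Sigma)], up to the constant [(d / 2) ln (2 pi)]. *)
Definition gpot nu x : R :=
  2^-1 * (qf (invmx nu.2) (col_of_tuple x - nu.1) + ln (\det nu.2)).

Lemma measurable_gpot nu : measurable_fun setT (gpot nu).
Proof.
apply: measurable_funM => //; apply: measurable_funD => //; exact: measurable_qf.
Qed.

Lemma gpot_aff m L z : L \in unitmx ->
  gpot (m, L *m L^T) (aff m L z) = 2^-1 * sqnorm z + ln `|\det L|.
Proof.
move=> Lu; have Ltu : L^T \in unitmx by rewrite unitmx_tr.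
rewrite /gpot /= /aff tuple_of_colK addrAC subrr add0r.
have -> : qf (invmx (L *m L^T)) (L *m col_of_tuple z) = sqnorm z.
  rewrite /sqnorm -qf_congr; congr qf.
  by rewrite invmx_mul// !mulmxA mulmxV// mul1mx mulVmx.
rewrite mulrDr det_mulmx det_tr -expr2 -real_normK ?num_real// lnXn; last first.
  by rewrite normr_gt0 -unitfE -unitmxE.
by lra.
Qed.

Local Open Scope ereal_scope.

(** The right side sees L only through L L^T, so every invertible factor of a covariance yields the
    same law. The image of a Gaussian under an affine map relies on this, since T Sigma^(1/2) is in
    general not symmetric. *)
Lemma ge0_integral_std_aff m L (f : Rtuple R d -> \bar R) : L \in unitmx ->
    measurable_fun setT f -> (forall x, 0 <= f x) ->
  \int[std_gaussian R d]_z f (aff m L z) =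
  vol (fun x => f x * (expR (- gpot (m, L *m L^T) x))%:E).
Proof.
move=> Lu mf f0; set g := (X in vol X).
have mg : measurable_fun setT g.
  apply: emeasurable_funM => //; apply/measurable_EFinP/measurableT_comp => //.
  by apply: measurable_funN; exact: measurable_gpot.
have g0 x : 0 <= g x by rewrite mule_ge0// lee_fin expR_ge0.
have Ln : (0 < `|\det L|)%R by rewrite normr_gt0 -unitfE -unitmxE.
have /esym := vol_aff m Lu mg g0.
move=> /(congr1 (fun t => (`|\det L|)%:E * t)).
rewrite muleA -EFinM mulfV ?lt0r_neq0// mul1e => ->.
rewrite /vol -ge0_integralZl//; last 2 first.
- apply: emeasurable_funM; first exact: measurable_comp_aff.
  apply/measurable_EFinP/measurableT_comp => //.
  by apply: measurable_funM => //; exact: measurable_sqnorm.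
- by move=> x _; rewrite mule_ge0// ?g0// lee_fin expR_ge0.
apply: eq_integral => z _; rewrite /g /= gpot_aff// -muleA -EFinM -expRD.
rewrite muleCA -EFinM -[X in (X * _)%R]lnK ?posrE// -expRD.
by rewrite (_ : (_ + _ = 0)%R) ?expR0 ?mule1//; field.
Qed.

Lemma ge0_integral_gaussian nu (f : Rtuple R d -> \bar R) : posdefmx nu.2 ->
    measurable_fun setT f -> (forall x, 0 <= f x) ->
  \int[gaussian nu]_x f x = vol (fun x => f x * (expR (- gpot nu x))%:E).
Proof.
move=> pS mf f0; have [pL LL] := sqrtmxP pS.
rewrite ge0_integral_distribution//.
rewrite [LHS](ge0_integral_std_aff nu.1 (posdef_unit pL) mf f0).
by rewrite (posdef_sym pL) LL -surjective_pairing.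
Qed.

Lemma ge0_integral_gaussian_aff nu m T (f : Rtuple R d -> \bar R) :
    posdefmx nu.2 -> T \in unitmx -> measurable_fun setT f -> (forall x, 0 <= f x) ->
  \int[gaussian nu]_x f (aff m T x) =
  \int[gaussian (m + T *m nu.1, T *m nu.2 *m T^T)%R]_x f x.
Proof.
move=> pS Tu mf f0; have [pL LL] := sqrtmxP pS; have Lu := posdef_unit pL.
have pTS : posdefmx (T *m nu.2 *m T^T).
  by rewrite -{1}[T]trmxK; apply: posdef_congr => //; rewrite unitmx_tr.
rewrite (@ge0_integral_gaussian (m + T *m nu.1, T *m nu.2 *m T^T)%R f pTS mf f0).
rewrite (ge0_integral_distribution _ (f := f \o aff m T))//=; last first.
  exact: measurable_comp_aff.
transitivity (\int[std_gaussian R d]_z f (aff (m + T *m nu.1) (T *m sqrtmx nu.2) z)).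
  by apply: eq_integral => z _ /=; rewrite -aff_comp.
have TLu : T *m sqrtmx nu.2 \in unitmx by rewrite unitmx_mul Tu.
rewrite [LHS](ge0_integral_std_aff _ TLu mf f0).
by rewrite trmx_mul (posdef_sym pL) mulmxA -(mulmxA T) LL.
Qed.

(** The density of [gaussian r] with respect to [gaussian nu]: the powers of 2 pi omitted from
    [gpot] cancel in the difference. *)
Definition gdens r nu x : R := expR (gpot nu x - gpot r x).

Lemma measurable_gdens r nu : measurable_fun setT (gdens r nu).
Proof.
by apply: measurableT_comp => //; apply: measurable_funB; exact: measurable_gpot.
Qed.

Lemma gdens_gt0 r nu x : (0 < gdens r nu x)%R. Proof. exact: expR_gt0. Qed.

Lemma ge0_integral_gdens r nu (f : Rtuple R d -> \bar R) :
    posdefmx r.2 -> posdefmx nu.2 -> measurable_fun setT f -> (forall x, 0 <= f x) ->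
  \int[gaussian r]_x f x = \int[gaussian nu]_x (f x * (gdens r nu x)%:E).
Proof.
move=> pr pn mf f0; pose g x := f x * (gdens r nu x)%:E.
have mg : measurable_fun setT g.
  by apply: emeasurable_funM => //; apply/measurable_EFinP; exact: measurable_gdens.
have g0 x : 0 <= g x by rewrite mule_ge0// lee_fin ltW// gdens_gt0.
rewrite (ge0_integral_gaussian pr mf f0) (ge0_integral_gaussian pn mg g0).
congr vol; apply/funext => x; rewrite /g -muleA -EFinM -expRD.
by congr (_ * (expR _)%:E); ring.
Qed.

Lemma gaussian_density r nu (A : set (Rtuple R d)) : posdefmx r.2 -> posdefmx nu.2 ->
  measurable A -> gaussian r A = \int[gaussian nu]_(x in A) (gdens r nu x)%:E.
Proof.
move=> pr pn mA; rewrite integral_mkcond epatch_indic.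
transitivity (\int[gaussian r]_x (\1_A x)%:E); first by rewrite integral_indic// setIT.
rewrite (@ge0_integral_gdens r nu)//; last exact/measurable_EFinP/measurable_indic.
by apply: eq_integral => x _; rewrite muleC.
Qed.

Lemma gaussian_dominates r nu : posdefmx r.2 -> posdefmx nu.2 -> gaussian r `<< gaussian nu.
Proof.
move=> pr pn; apply: (density_dominates (rho := fun x => (gdens r nu x)%:E)).
  by move=> A mA; exact: gaussian_density.
by apply/measurable_EFinP; exact: measurable_gdens.
Qed.

(** Up to a positive constant the integrand is the density of N(0, 2 I) relative to the standard
    Gaussian, whose integral is 1. *)
Lemma std_exp_integral_lty :
  \int[std_gaussian R d]_x (expR (sqnorm x / 4))%:E < +oo.
Proof.
have Lu : ((Num.sqrt 2)%:M : 'M[R]_d) \in unitmx.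
  by apply: (@posdef_unit R d); apply: posdef_scalar; rewrite sqrtr_gt0.
have := ge0_integral_std_aff 0%R Lu (measurable_cst 1) (fun=> lee01).
rewrite integral_cst// [X in _ * X]probability_setT mul1e tr_scalar_mx -scalar_mxM -expr2 sqr_sqrtr//.
pose c := expR (- (2^-1 * ln (\det (2%:M : 'M[R]_d)))).
have E x : (- gpot (0%R, 2%:M) x + sqnorm x / 2 = sqnorm x / 4 - 2^-1 * ln (\det (2%:M : 'M[R]_d)))%R.
  rewrite /gpot/= invmx_scalar subr0 -[X in X%:M]mulr1 -scale_scalar_mx qfZ -/(sqnorm x).
  by field.
rewrite /vol => H.
have : 1 = \int[std_gaussian R d]_x (c%:E * (expR (sqnorm x / 4))%:E).
  rewrite H; apply: eq_integral => x _; rewrite mul1e -EFinM -expRD E expRD EFinM.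
  by rewrite muleC.
rewrite ge0_integralZl//; last 2 first.
- apply/measurable_EFinP/measurableT_comp => //.
  by apply: measurable_funM => //; exact: measurable_sqnorm.
- by rewrite lee_fin expR_ge0.
have c0 : (0 < c)%R by exact: expR_gt0.
case: (\int[std_gaussian R d]_x _) => [r|//|//]; first by rewrite ltry.
by rewrite gt0_muley.
Qed.

Definition finite_moment2 (p : {measure set (Rtuple R d) -> \bar R}) :=
  (forall i, p.-integrable setT (fun x => (col_of_tuple x i 0%R)%:E)) /\
  (forall i j, p.-integrable setT (fun x => (col_of_tuple x i 0%R * col_of_tuple x j 0%R)%:E)).

Lemma std_finite_moment2 : finite_moment2 (std_gaussian R d).
Proof.
have iexp : (std_gaussian R d).-integrable setT (fun x => (4 * expR (sqnorm x / 4))%:E).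
  under eq_fun do rewrite EFinM.
  apply: integrableZl => //; apply/integrableP; split.
    apply/measurable_EFinP/measurableT_comp => //.
    by apply: measurable_funM => //; exact: measurable_sqnorm.
  by under eq_integral do rewrite gee0_abs ?lee_fin ?expR_ge0//; exact: std_exp_integral_lty.
have sq x i : (col_of_tuple x i 0 ^+ 2 <= sqnorm x)%R.
  by rewrite /sqnorm qf1 (bigD1 i)//= lerDl sumr_ge0// => j _; exact: sqr_ge0.
(* From 1 + t <= exp t at t = |x|^2 / 4. The spare -4 absorbs the constant in |a| <= (a^2 + 1) / 2,
   so one integrable function dominates the moments of both orders. *)
have le4 x : (sqnorm x <= 4 * expR (sqnorm x / 4) - 4)%R.
  by have := expR_ge1Dx (sqnorm x / 4); lra.
have mij i : measurable_fun setT (fun x : Rtuple R d => col_of_tuple x i 0%R).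
  exact: measurable_coord.
split=> [i|i j]; apply: (le_integrable measurableT _ _ iexp).
- exact/measurable_EFinP.
- move=> x _; rewrite !abse_EFin lee_fin [leRHS]ger0_norm ?mulr_ge0 ?expR_ge0//.
  have := sq x i; have := le4 x; rewrite ler_norml; set a := col_of_tuple _ _ _.
  have := sqr_ge0 (a - 1)%R; have := sqr_ge0 (a + 1)%R.
  by nra.
- by apply/measurable_EFinP; apply: measurable_funM.
- move=> x _; rewrite !abse_EFin lee_fin [leRHS]ger0_norm ?mulr_ge0 ?expR_ge0//.
  have := sq x i; have := sq x j; have := le4 x; rewrite ler_norml.
  set a := col_of_tuple _ _ _; set b := col_of_tuple _ _ _.
  have := sqr_ge0 (a - b)%R; have := sqr_ge0 (a + b)%R.
  by nra.
Qed.

Lemma gaussian_finite_moment2 nu : finite_moment2 (gaussian nu).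
Proof.
have [iz izz] := std_finite_moment2.
have E z i : col_of_tuple (affine_map nu z) i 0%R =
  (nu.1 i 0 + \sum_j sqrtmx nu.2 i j * col_of_tuple z j 0)%R.
  by rewrite mxE tnth_mktuple !mxE.
have i1 i : (std_gaussian R d).-integrable setT
    (fun z => (\sum_j sqrtmx nu.2 i j * col_of_tuple z j 0)%:E)%R.
  under eq_fun do rewrite -sumEFin.
  by apply: integrable_sum => // j _; under eq_fun do rewrite EFinM; exact: integrableZl.
have ic c : (std_gaussian R d).-integrable setT (fun z => c%:E).
  exact: finite_measure_integrable_cst.
have mi i : measurable_fun setT (fun x : Rtuple R d => col_of_tuple x i 0%R).
  exact: measurable_coord.
have push (f : Rtuple R d -> R) : measurable_fun setT f ->
    (std_gaussian R d).-integrable setT (fun z => (f (affine_map nu z))%:E) ->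
    (gaussian nu).-integrable setT (fun x => (f x)%:E).
  move=> mf fi; apply/integrableP; split; first exact/measurable_EFinP.
  rewrite ge0_integral_distribution//; last first.
    by apply: measurableT_comp => //; exact/measurable_EFinP.
  by have /integrableP[] := fi.
split=> [i|i j]; apply: push => //; try exact: measurable_funM.
  under eq_fun do rewrite E EFinD.
  exact: integrableD.
under eq_fun do rewrite !E mulrDl !mulrDr !EFinD.
apply: integrableD => //; apply: integrableD => //.
- by under eq_fun do rewrite EFinM; exact: integrableZl.
- by under eq_fun do rewrite EFinM muleC; exact: integrableZl.
- under eq_fun do rewrite big_distrlr/= -sumEFin.
  apply: integrable_sum => // k _; under eq_fun do rewrite -sumEFin.
  apply: integrable_sum => // l _; under eq_fun do rewrite mulrACA EFinM.
  exact: integrableZl.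
Qed.

End gaussian_density.

(** * Relative entropy and the dual bound *)

Section relative_entropy.
Context (R : realType) (d : nat).
Notation P := (probability (Rtuple R d) R).
Local Open Scope ereal_scope.
Local Open Scope charge_scope.

Section density_version.
Variables p mu : P.
Hypothesis pmu : p `<< mu.

Let f := 'd (charge_of_finite_measure p) '/d mu.
Let fr x : R := fine (f x).

Let frE x : f x = (fr x)%:E.
Proof. by rewrite /fr fineK//; exact: Radon_Nikodym_fin_num. Qed.

Let mf : measurable_fun setT f.
Proof. by apply: measurable_int; exact: Radon_Nikodym_integrable. Qed.

Let mfr : measurable_fun setT fr.
Proof. by apply/measurable_EFinP; rewrite (_ : _ \o _ = f)//; apply/funext => x; rewrite frE. Qed.

Let mpos : measurable_fun setT (fun x => (0 < fr x)%R).
Proof. by apply: measurable_fun_ltr. Qed.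

(** The Radon-Nikodym derivative may fail to be positive on a [p]-null set. Replacing it there by 1
    makes its logarithm finite everywhere without affecting integrals against [p]. *)
Definition posdens x : R := if (0 < fr x)%R then fr x else 1%R.

Lemma posdens_gt0 x : (0 < posdens x)%R.
Proof. by rewrite /posdens; case: ifP. Qed.

Lemma measurable_posdens : measurable_fun setT posdens.
Proof. exact: measurable_fun_ifT. Qed.

Let ae_pos : {ae p, forall x, (0 < fr x)%R}.
Proof.
set N := [set x | ~~ (0 < fr x)%R].
have mN : measurable N.
  rewrite (_ : N = setT `&` (fun x => (0 < fr x)%R) @^-1` [set false]).
    exact: mpos.
  by rewrite setTI; apply/seteqP; split => x /=; [move/negbTE|rewrite /N/= => ->].
exists N; split => //; last by move=> x /= /negP.
apply/eqP; rewrite eq_le measure_ge0 andbT.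
rewrite [leLHS](Radon_Nikodym_integral (nu := charge_of_finite_measure p) pmu mN).
rewrite -(integral0 mu N); apply: le_integral => //.
- by apply: (integrableS measurableT) => //; exact: Radon_Nikodym_integrable.
- exact: integrable0.
- by move=> x /[!inE] /= Nx; rewrite -/(f x) frE lee_fin leNgt.
Qed.

Let mlnF : measurable_fun setT (fun x => (ln (posdens x))%:E).
Proof.
apply/measurable_EFinP; apply: measurableT_comp; [exact: measurable_ln|exact: measurable_posdens].
Qed.

Lemma KL_posdens : KL p mu = \int[p]_x (ln (posdens x))%:E.
Proof.
rewrite /KL; case: asboolP => // _.
apply: ae_eq_integral => //.
- rewrite (_ : (fun x => _) = fun x => if (0 < fr x)%R then (ln (fr x))%:E else -oo).
    apply: measurable_fun_ifT => //.
    by apply/measurable_EFinP; apply: measurableT_comp => //; exact: measurable_ln.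
  apply/funext => x; rewrite -/(f x) frE.
  case: ifPn => h; first by rewrite lne_EFin.
  by rewrite le0_lneNy// lee_fin leNgt.
- apply: filterS ae_pos => x h _ /=.
  by rewrite -/(f x) frE lne_EFin// /posdens h.
Qed.

(** Division cancels the density of [p], leaving the integral of [rho] over the set where that
    density is positive. The part of [mu] outside this set is lost, hence an inequality. *)
Lemma integral_div_posdens (rho : Rtuple R d -> R) :
  measurable_fun setT rho -> (forall x, 0 <= rho x)%R ->
  \int[p]_x (rho x / posdens x)%:E <= \int[mu]_x (rho x)%:E.
Proof.
move=> mrho rho0.
have mq : measurable_fun setT (fun x => (rho x / posdens x)%:E).
  rewrite (_ : (fun x => _) = fun x => (rho x * expR (- ln (posdens x)))%:E).
    apply/measurable_EFinP; apply: measurable_funM => //; apply: measurableT_comp => //.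
    exact/measurable_funN/measurable_EFinP.
  by apply/funext => x; rewrite expRN lnK// posrE posdens_gt0.
have q0 x : 0 <= (rho x / posdens x)%:E by rewrite lee_fin divr_ge0// ltW// posdens_gt0.
rewrite -(Radon_Nikodym_SigmaFinite.change_of_variables pmu q0)//.
apply: ae_ge0_le_integral => //.
- by move=> x _; rewrite mule_ge0// Radon_Nikodym_SigmaFinite.f_ge0.
- apply: emeasurable_funM => //.
  exact: measurable_int (Radon_Nikodym_SigmaFinite.f_integrable pmu).
- by move=> x _; rewrite lee_fin.
- exact/measurable_EFinP.
have := ae_eq_Radon_Nikodym_SigmaFinite pmu measurableT.
apply: filterS => x /(_ I) e _; rewrite e -/(f x) frE -EFinM lee_fin /posdens.
case: ifPn => h; first by rewrite divfK// gt_eqF.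
by rewrite divr1 (le_trans (mulr_ge0_le0 _ _))// leNgt.
Qed.

Lemma KL_density (rho : Rtuple R d -> R) : measurable_fun setT rho ->
    (forall x, 0 < rho x)%R ->
    (forall A, measurable A -> p A = \int[mu]_(x in A) (rho x)%:E) ->
  KL p mu = \int[p]_x (ln (rho x))%:E.
Proof.
move=> mrho rho0 pE; rewrite KL_posdens; apply: ae_eq_integral => //.
  apply/measurable_EFinP; apply: measurableT_comp => //; exact: measurable_ln.
apply: (null_dominates_ae_eq _ pmu) => //.
have := ae_eq_Radon_Nikodym_SigmaFinite pmu measurableT => fE.
have : ae_eq mu setT f (EFin \o rho).
  apply: integral_ae_eq => //.
  - exact: Radon_Nikodym_integrable.
  - exact/measurable_EFinP.
  - by move=> A _ mA; rewrite -pE// -Radon_Nikodym_integral.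
apply: filterS => x /(_ I) /=; rewrite frE => -[frx] _.
by rewrite /posdens frx rho0.
Qed.

(** The negative part of ln t is at most 1 / t, and the reciprocal of the density has [p]-integral
    at most the mass of [mu]. Thus the entropy integral never takes the value -oo. *)
Let lnF_neg_lty : \int[p]_x (EFin \o (@ln R \o posdens))^\- x < +oo.
Proof.
apply: (@le_lt_trans _ _ (\int[mu]_x 1%:E)); last first.
  by rewrite integral_cst// [X in _ * X]probability_setT mule1 ltry.
apply: le_trans (integral_div_posdens (rho := cst 1%R) _ _) => //.
apply: ge0_le_integral => //.
- exact: measurable_funeneg.
- apply/measurable_EFinP; rewrite (_ : (fun x => _) = fun x => expR (- ln (posdens x))).
    by apply: measurableT_comp => //; exact/measurable_funN/measurable_EFinP.
  by apply/funext => x; rewrite expRN lnK ?posrE ?posdens_gt0//= mul1r.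
- move=> x _; rewrite funenegE/= ge_max !lee_fin mul1r.
  apply/andP; split; last by rewrite invr_ge0 ltW// posdens_gt0.
  by rewrite -lnV ?posrE ?posdens_gt0// ltW// ln_sublinear// invr_gt0 posdens_gt0.
Qed.

Lemma integrable_ln_posdens : KL p mu < +oo ->
  p.-integrable setT (fun x => (ln (posdens x))%:E).
Proof.
rewrite KL_posdens integralE => H; apply/integrableP; split => //.
rewrite -/(abse \o _) (_ : abse \o _ = abse \o (EFin \o (@ln R \o posdens)))//.
rewrite fune_abse ge0_integralD//; [|exact: measurable_funepos|exact: measurable_funeneg].
rewrite lte_add_pinfty// ltNge leye_eq; apply/negP => /eqP Hy.
by move: H; rewrite Hy addye ?ltxx// eqe_oppLR/= lt_eqF.
Qed.

Lemma KL_dominated_gtNy : -oo < KL p mu.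
Proof.
rewrite KL_posdens integralE.
have : 0 <= \int[p]_x (EFin \o (@ln R \o posdens))^\+ x by exact: integral_ge0.
have : 0 <= \int[p]_x (EFin \o (@ln R \o posdens))^\- x by exact: integral_ge0.
move: lnF_neg_lty.
rewrite -[X in _ < X - _]/(\int[p]_x (EFin \o (@ln R \o posdens))^\+ x).
rewrite -[X in _ < _ - X]/(\int[p]_x (EFin \o (@ln R \o posdens))^\- x).
case: (\int[p]_x _^\- x) => [b| |]//; case: (\int[p]_x _^\+ x) => [a| |]//.
by rewrite -EFinB ltNyr.
Qed.

End density_version.

Lemma KL_gtNy (p mu : P) : -oo < KL p mu.
Proof.
have [pmu|npmu] := pselect (p `<< mu); first exact: KL_dominated_gtNy.
by rewrite /KL; case: asboolP.
Qed.

Lemma KL_lty_dominates (p mu : P) : KL p mu < +oo -> p `<< mu.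
Proof. by rewrite /KL; case: asboolP => //; rewrite ltxx. Qed.

End relative_entropy.

Section image_measure.
Context d1 d2 (X : measurableType d1) (Y : measurableType d2) (R : realType).
Variables (phi : X -> Y) (pi : {measure set X -> \bar R}) (p : {measure set Y -> \bar R}).
Hypotheses (mphi : measurable_fun setT phi)
  (pE : forall A, measurable A -> pi (phi @^-1` A) = p A).
Local Open Scope ereal_scope.

Lemma ge0_integral_image (h : Y -> \bar R) : measurable_fun setT h ->
  (forall y, 0 <= h y) -> \int[pi]_x h (phi x) = \int[p]_y h y.
Proof.
move=> mh h0; rewrite -(ge0_integral_pushforward mphi pi measurableT mh (fun y _ => h0 y)).
by apply: eq_measure_integral => // A mA _; rewrite -pE.
Qed.

Lemma integrable_image (h : Y -> \bar R) : p.-integrable setT h ->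
  pi.-integrable setT (fun x => h (phi x)).
Proof.
move=> /integrableP[mh hoo]; apply/integrableP; split; first exact: measurableT_comp mh mphi.
by rewrite (@ge0_integral_image (abse \o h))//=; exact: measurableT_comp.
Qed.

Lemma integral_image (h : Y -> \bar R) : measurable_fun setT h ->
  \int[pi]_x h (phi x) = \int[p]_y h y.
Proof.
move=> mh; rewrite -[LHS]/(\int[pi]_x (h \o phi) x) integralE funepos_comp funeneg_comp.
rewrite [RHS]integralE; congr (_ - _); apply: ge0_integral_image => //.
- exact: measurable_funepos.
- exact: measurable_funeneg.
Qed.

End image_measure.

(** * Weak duality *)

Section dual_bound.
Context (R : realType) (d : nat).
Notation P := (probability (Rtuple R d) R).
Variables (tau0 tau1 : R) (mu nu p q : P) (rho0 rho1 : Rtuple R d -> R) (K : R).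
Hypotheses (tau0_gt0 : 0 < tau0) (tau1_gt0 : 0 < tau1).
Hypotheses (mrho0 : measurable_fun setT rho0) (mrho1 : measurable_fun setT rho1).
Hypotheses (rho0_gt0 : forall x, 0 < rho0 x) (rho1_gt0 : forall x, 0 < rho1 x).
Hypotheses (irho0 : (\int[mu]_x (rho0 x)%:E <= 1)%E)
  (irho1 : (\int[nu]_x (rho1 x)%:E <= 1)%E).
Hypothesis rhoK : forall x y, K <= sqdist x y + tau0 * ln (rho0 x) + tau1 * ln (rho1 y).
Local Open Scope ereal_scope.

Lemma measurable_sqdist :
  measurable_fun setT (fun z : Rtuple R d * Rtuple R d => sqdist z.1 z.2).
Proof.
apply: measurable_sum => i; apply: measurable_funX; apply: measurable_funB.
  exact: (measurableT_comp (@measurable_tnth _ _ d i) measurable_fst).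
exact: (measurableT_comp (@measurable_tnth _ _ d i) measurable_snd).
Qed.

Lemma sqdist_ge0 (x y : Rtuple R d) : (0 <= sqdist x y)%R.
Proof. by apply: sumr_ge0 => i _; exact: sqr_ge0. Qed.

Let div_integrable (m r : P) (rho : Rtuple R d -> R) (rm : r `<< m) :
  measurable_fun setT rho -> (forall x, 0 < rho x)%R -> \int[m]_x (rho x)%:E <= 1 ->
  r.-integrable setT (fun x => (rho x / posdens r m x)%:E) /\
  (\int[r]_x (rho x / posdens r m x) <= 1)%R.
Proof.
move=> mrho rho_gt0 irho.
have le1 := le_trans (integral_div_posdens rm mrho (fun x => ltW (rho_gt0 x))) irho.
have ge0 x : (0 <= rho x / posdens r m x)%R by rewrite divr_ge0// ltW// posdens_gt0.
have idiv : r.-integrable setT (fun x => (rho x / posdens r m x)%:E).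
  apply/integrableP; split.
    apply/measurable_EFinP; rewrite (_ : (fun x => _) = fun x => (rho x * expR (- ln (posdens r m x)))%R).
      apply: measurable_funM => //; apply: measurableT_comp => //; apply: measurable_funN.
      by apply: measurableT_comp (measurable_posdens rm); exact: measurable_ln.
    by apply/funext => x; rewrite expRN lnK// posrE posdens_gt0.
  under eq_integral do rewrite gee0_abs ?lee_fin//.
  exact: le_lt_trans le1 (ltry _).
split=> //; rewrite -lee_fin [leLHS]fineK//; exact: integrable_fin_num.
Qed.

Let ln_lower (a b : R) : (0 < a)%R -> (0 < b)%R -> (ln b + (1 - b / a) <= ln a)%R.
Proof.
move=> a0 b0; have /le_ln1Dx : (-1 < b / a - 1)%R by rewrite ltrBrDl subrr divr_gt0.
by rewrite addrCA subrr addr0 ln_div ?posrE//; lra.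
Qed.

Let dual_bound_coupling (pi : probability (Rtuple R d * Rtuple R d)%type R) :
    couplings p q pi -> \int[pi]_z (sqdist z.1 z.2)%:E < +oo ->
    KL p mu < +oo -> KL q nu < +oo ->
  K%:E <= \int[pi]_z (sqdist z.1 z.2)%:E + tau0%:E * KL p mu + tau1%:E * KL q nu.
Proof.
move=> piE coo KLp KLq.
have pmu := KL_lty_dominates KLp; have qnu := KL_lty_dominates KLq.
have iF := integrable_ln_posdens pmu KLp; have iG := integrable_ln_posdens qnu KLq.
have pi1 A : measurable A -> pi (fst @^-1` A) = p A.
  by move=> mA; have [<- _] := piE _ mA; congr (pi _); apply/seteqP; split=> [[x y]|[x y]]//= [].
have pi2 A : measurable A -> pi (snd @^-1` A) = q A.
  by move=> mA; have [_ <-] := piE _ mA; congr (pi _); apply/seteqP; split=> [[x y]|[x y]]//= [].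
have ic : pi.-integrable setT (fun z => (sqdist z.1 z.2)%:E).
  apply/integrableP; split.
    by apply/measurable_EFinP; exact: measurable_sqdist.
  by under eq_integral do rewrite gee0_abs ?lee_fin ?sqdist_ge0//.
have [ir0 le0] := div_integrable pmu mrho0 rho0_gt0 irho0.
have [ir1 le1] := div_integrable qnu mrho1 rho1_gt0 irho1.
have iF' := integrable_image measurable_fst pi1 iF.
have iG' := integrable_image measurable_snd pi2 iG.
have ir0' := integrable_image measurable_fst pi1 ir0.
have ir1' := integrable_image measurable_snd pi2 ir1.
have Rimg (phi : Rtuple R d * Rtuple R d -> Rtuple R d) (r : P) (h : Rtuple R d -> R) :
    measurable_fun setT phi -> (forall A, measurable A -> pi (phi @^-1` A) = r A) ->
    r.-integrable setT (EFin \o h) -> (\int[pi]_z h (phi z) = \int[r]_x h x)%R.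
  move=> mphi rE /measurable_int mh; congr fine.
  by rewrite -(integral_image mphi rE mh).
have icst c : pi.-integrable setT (fun z => c%:E) by exact: finite_measure_integrable_cst.
have EK (r m : P) : r `<< m -> r.-integrable setT (fun x => (ln (posdens r m x))%:E) ->
    KL r m = (\int[r]_x (ln (posdens r m x)))%R%:E.
  by move=> rm ir; rewrite (KL_posdens rm) fineK//; exact: integrable_fin_num.
rewrite (EK _ _ pmu iF) (EK _ _ qnu iG).
have -> : \int[pi]_z (sqdist z.1 z.2)%:E = (\int[pi]_z (sqdist z.1 z.2))%R%:E.
  by rewrite fineK//; exact: integrable_fin_num.
rewrite -!EFinM -!EFinD lee_fin.
rewrite -(Rimg _ _ _ measurable_fst pi1 iF) -(Rimg _ _ _ measurable_snd pi2 iG).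
move: le0 le1.
rewrite -(Rimg _ _ _ measurable_fst pi1 ir0) -(Rimg _ _ _ measurable_snd pi2 ir1).
move=> le0 le1.
have iZ c (f : Rtuple R d * Rtuple R d -> R) : pi.-integrable setT (EFin \o f) ->
    pi.-integrable setT (EFin \o (fun z => c * f z)%R).
  by move=> fi; rewrite (_ : EFin \o _ = fun z => c%:E * (f z)%:E)//; exact: integrableZl.
have iD (f g : Rtuple R d * Rtuple R d -> R) : pi.-integrable setT (EFin \o f) ->
    pi.-integrable setT (EFin \o g) -> pi.-integrable setT (EFin \o (fun z => f z + g z)%R).
  by move=> fi gi; rewrite (_ : EFin \o _ = (EFin \o f) \+ (EFin \o g))//; exact: integrableD.
rewrite -!RintegralZl// -!RintegralD//; [|by do ?[apply: (iD)|apply: (iZ)]..].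
(* This minorant retains only the ratios of trial to actual density, which are integrable. The terms
   ln [rho0] and ln [rho1] have been removed by [rhoK] and are never integrated; each ratio has
   integral at most 1, so the integral of [f] is at least [K]. *)
pose f z : R := (K + (tau0 + tau1 + ((- tau0) * (rho0 z.1 / posdens p mu z.1)
    + (- tau1) * (rho1 z.2 / posdens q nu z.2))))%R.
have fi : pi.-integrable setT (EFin \o f).
  by apply: (iD _ _ (icst K)); apply: (iD _ _ (icst (tau0 + tau1)%R)); apply: (iD); exact: iZ.
apply: (@le_trans _ _ (\int[pi]_z f z)%R).
  rewrite /f; rewrite !RintegralD//; [|by do ?[apply: (iD)|apply: (iZ)|apply: (icst)]..].
  rewrite !RintegralZl// !Rintegral_cst// [X in fine X]probability_setT/= !mulr1.
  set a := Rintegral _ _ _ in le0 *; set b := Rintegral _ _ _ in le1 *.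
  have := mulr_ge0 (ltW tau0_gt0) (_ : 0 <= 1 - a)%R; rewrite subr_ge0 => /(_ le0).
  have := mulr_ge0 (ltW tau1_gt0) (_ : 0 <= 1 - b)%R; rewrite subr_ge0 => /(_ le1).
  by lra.
apply: le_Rintegral => //; first by do ?[apply: (iD)|apply: (iZ)].
move=> z _; rewrite /f; have := rhoK z.1 z.2.
have := ln_lower (posdens_gt0 p mu z.1) (rho0_gt0 z.1).
have := ln_lower (posdens_gt0 q nu z.2) (rho1_gt0 z.2).
set A := ln (posdens _ _ _); set B := ln (posdens _ _ _).
set r := (_ / _)%R; set t := (_ / _)%R.
rewrite -(ler_pM2l tau1_gt0) => h1; rewrite -(ler_pM2l tau0_gt0) => h2.
by lra.
Qed.

Lemma W2sq_ge0 : 0 <= W2sq p q.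
Proof.
apply: le_ereal_inf_tmp => _ [pi _ <-]; apply: integral_ge0 => z _.
by rewrite lee_fin sqdist_ge0.
Qed.

(** As neither entropy is -oo, an infinite entropy or an infinite coupling cost makes the bound
    trivial. Otherwise the entropies are finite and can be moved across to pass to the infimum over
    couplings. *)
Lemma dual_bound : K%:E <= W2sq p q + tau0%:E * KL p mu + tau1%:E * KL q nu.
Proof.
have KLp := KL_gtNy p mu; have KLq := KL_gtNy q nu.
have mulNy tau (k : \bar R) : (0 < tau)%R -> -oo < k -> tau%:E * k != -oo.
  by move=> t0; case: k => [r|_|//]; rewrite ?gt0_muley ?lte_fin// -EFinM.
have W0 : W2sq p q != -oo by rewrite gt_eqF// (lt_le_trans (ltNyr 0%R))// W2sq_ge0.
have [KLpy|KLpoo] := eqVneq (KL p mu) +oo.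
  by rewrite KLpy gt0_muley ?lte_fin// addey// addye ?leey// mulNy.
have [KLqy|KLqoo] := eqVneq (KL q nu) +oo.
  rewrite KLqy (gt0_muley (x := tau1%:E)) ?lte_fin// addey ?leey//.
  by rewrite adde_eq_ninfty negb_or W0 mulNy.
rewrite -addeA -leeBlDr; last by rewrite fin_numD !fin_numM// fin_numE ?KLpoo ?KLqoo gt_eqF.
apply: le_ereal_inf_tmp => _ [pi piE <-].
rewrite leeBlDr; last by rewrite fin_numD !fin_numM// fin_numE ?KLpoo ?KLqoo gt_eqF.
have [coo|] := ltP (\int[pi]_z (sqdist z.1 z.2)%:E) +oo.
  by rewrite addeA; apply: dual_bound_coupling => //; rewrite ltey.
rewrite leye_eq => /eqP ->; rewrite addye ?leey//.
by rewrite adde_eq_ninfty negb_or !mulNy.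
Qed.

End dual_bound.

(** * Differential calculus on matrices *)

Section differential_calculus.
Context (R : realType) (V : normedModType R).
Implicit Types (f g L U : V -> R) (x v h : V).

Lemma differentiable_bigsum (I : Type) (s : seq I) (P : pred I) (f : I -> V -> R) x :
  (forall i, differentiable (f i) x) -> differentiable (fun y => \sum_(i <- s | P i) f i y) x.
Proof.
move=> df; elim: s => [|i s IH].
  by rewrite (_ : (fun y => _) = cst 0)//; apply/funext => y; rewrite big_nil.
rewrite (_ : (fun y => _) = if P i then (fun y => f i y + \sum_(j <- s | P j) f j y)
  else (fun y => \sum_(j <- s | P j) f j y)).
  by case: ifP => // _; exact: differentiableD.
by apply/funext => y; rewrite big_cons; case: ifP.
Qed.

Lemma differentiable_bigprod (I : Type) (s : seq I) (P : pred I) (f : I -> V -> R) x :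
  (forall i, differentiable (f i) x) -> differentiable (fun y => \prod_(i <- s | P i) f i y) x.
Proof.
move=> df; elim: s => [|i s IH].
  by rewrite (_ : (fun y => _) = cst 1)//; apply/funext => y; rewrite big_nil.
rewrite (_ : (fun y => _) = if P i then (fun y => f i y * \prod_(j <- s | P j) f j y)
  else (fun y => \prod_(j <- s | P j) f j y)).
  by case: ifP => // _; exact: differentiableM.
by apply/funext => y; rewrite big_cons; case: ifP.
Qed.

Lemma diff_chain (phi : R -> R) f x (c : R) : is_derive (f x) 1 phi c ->
  differentiable f x ->
  differentiable (phi \o f) x /\ forall v, 'd (phi \o f) x v = c * 'd f x v.
Proof.
move=> [dphi phiE] df.
have dphi' : differentiable phi (f x) by exact/derivable1_diffP.
split; first exact: differentiable_comp.
by move=> v; rewrite diff_comp//= deriv1E// derive1E phiE mulrC.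
Qed.

Lemma diff_remainder f x (e : R) : differentiable f x -> 0 < e ->
  \forall h \near 0, `|f (h + x) - f x - 'd f x h| <= e * `|h|.
Proof.
move=> /diff_locally /eqaddoP/(_ e) H e0; have := H e0; apply: filterS => h.
by rewrite /cst !fctE/= opprD addrA.
Qed.

Lemma diff_of_remainder f x (df : {linear V -> R}) : continuous df ->
    (forall e, 0 < e -> \forall h \near 0, `|f (h + x) - f x - df h| <= e * `|h|) ->
  differentiable f x /\ forall h, 'd f x h = df h.
Proof.
move=> cdf H.
have E : f \o shift x = cst (f x) + df +o_ 0 id.
  apply/eqaddoP => e e0; apply: filterS (H _ e0) => h.
  by rewrite /cst !fctE/= opprD addrA.
have dE := diff_unique cdf E; split; last by move=> h; rewrite dE.
by apply/diff_locallyP; rewrite dE.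
Qed.

Lemma ge0_near_min_diff g x : (\forall y \near x, 0 <= g y) -> g x = 0 ->
  differentiable g x -> forall v, 'd g x v = 0.
Proof.
move=> g0 gx dg; suff ge0 v : 0 <= 'd g x v.
  move=> v; apply/eqP; rewrite eq_le ge0 andbT -oppr_ge0.
  by have := ge0 (- v); rewrite linearN.
have ge0_near : \forall h \near 0, 0 <= g (h + x).
  by move: g0; rewrite (near_shift 0 x) subr0.
apply/ler_addgt0Pl => e e0.
have [->|vn0] := eqVneq v 0; first by rewrite linear0 addr0 ltW.
have nv : 0 < `|v| by rewrite normr_gt0.
have e'0 : 0 < e / `|v| by rewrite divr_gt0.
have : \forall h \near 0, 0 <= g (h + x) /\
    `|g (h + x) - g x - 'd g x h| <= e / `|v| * `|h|.
  by apply: filterI ge0_near _; exact: diff_remainder.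
move=> /nbhs_ballP[d /= d0 Hd].
pose t := d / (2 * `|v|).
have t0 : 0 < t by rewrite divr_gt0// mulr_gt0.
have /Hd[/=] : ball 0 d (t *: v).
  rewrite -ball_normE/= sub0r normrN normrZ gtr0_norm// /t.
  by rewrite invfM mulrA divfK ?gt_eqF// ltr_pdivrMr// ltr_pMr// ltr1n.
rewrite gx subr0 => h1; rewrite linearZ/= normrZ gtr0_norm// mulrCA divfK ?gt_eqF//.
rewrite ler_norml => /andP[_]; rewrite lerBlDr => h2.
have : 0 <= t * (e + 'd g x v) by rewrite mulrDr (le_trans h1).
by rewrite pmulr_rge0.
Qed.

(* The two touching functions have the same differential, since their difference
   is minimal at the contact point. *)
Lemma sandwich_diff f L U x : (\forall y \near x, L y <= f y <= U y) ->
    L x = f x -> U x = f x -> differentiable L x -> differentiable U x ->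
  differentiable f x /\ forall h, 'd f x h = 'd U x h.
Proof.
move=> LfU Lx Ux dL dU.
have LU h : 'd L x h = 'd U x h.
  have := @ge0_near_min_diff (U - L) x _ _ (differentiableB dU dL) h.
  rewrite diffB//= => H; apply/esym/subr0_eq/H; last by rewrite !fctE Ux Lx subrr.
  by apply: filterS LfU => y /andP[h1 h2]; rewrite !fctE subr_ge0 (le_trans h1).
have near0 : \forall h \near 0, L (h + x) <= f (h + x) <= U (h + x).
  by move: LfU; rewrite (near_shift 0 x) subr0.
apply: diff_of_remainder => [|e e0]; first exact: diff_continuous.
apply: filterS3 near0 (diff_remainder dL e0) (diff_remainder dU e0) => h /andP[h1 h2].
rewrite LU Lx Ux !ler_norml => /andP[lb _] /andP[_ ub].
apply/andP; split; [apply: le_trans lb _|apply: le_trans _ ub];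
  by rewrite lerD2r lerD2r.
Qed.

End differential_calculus.

(** * Differentials of determinants and inverses *)

Section matrix_calculus.
Context (R : realType).

(** The cofactor formula without the invertibility test of [invmx]: its entries are rational
    functions of the entries of [A], so differentiability follows from sums, products and a
    reciprocal. *)
Definition adjinv n (A : 'M[R]_n) : 'M[R]_n := (\det A)^-1 *: \adj A.

Lemma adjinvE n (A : 'M[R]_n) : A \in unitmx -> adjinv A = invmx A.
Proof. by move=> Au; rewrite /invmx Au. Qed.

Lemma det_posdef n (A : 'M[R]_n) : posdefmx A -> 0 < \det A.
Proof.
move=> pA; have [pL <-] := sqrtmxP pA; rewrite det_mulmx -expr2.
by rewrite exprn_even_gt0//= -unitfE -unitmxE posdef_unit.
Qed.

Section mxdiff.
Context (V : normedModType R).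

Definition mxdiff m n (M : V -> 'M[R]_(m, n)) x :=
  forall i j, differentiable (fun y => M y i j) x.

Lemma mxdiff_cst m n (A : 'M[R]_(m, n)) x : mxdiff (fun=> A) x.
Proof. by move=> i j; exact: differentiable_cst. Qed.

Lemma mxdiffD m n (M N : V -> 'M[R]_(m, n)) x :
  mxdiff M x -> mxdiff N x -> mxdiff (fun y => M y + N y) x.
Proof.
by move=> dM dN i j; under eq_fun do rewrite mxE; exact: differentiableD.
Qed.

Lemma mxdiffB m n (M N : V -> 'M[R]_(m, n)) x :
  mxdiff M x -> mxdiff N x -> mxdiff (fun y => M y - N y) x.
Proof.
by move=> dM dN i j; under eq_fun do rewrite !mxE; exact: differentiableB.
Qed.

Lemma mxdiffM m n p (M : V -> 'M[R]_(m, n)) (N : V -> 'M[R]_(n, p)) x :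
  mxdiff M x -> mxdiff N x -> mxdiff (fun y => M y *m N y) x.
Proof.
move=> dM dN i j; under eq_fun do rewrite mxE.
by apply: differentiable_bigsum => k; exact: differentiableM.
Qed.

Lemma mxdiff_tr m n (M : V -> 'M[R]_(m, n)) x : mxdiff M x -> mxdiff (fun y => (M y)^T) x.
Proof. by move=> dM i j; under eq_fun do rewrite mxE; exact: dM. Qed.

Lemma differentiable_qf n (M : V -> 'M[R]_n) (u : V -> 'cV[R]_n) x :
  mxdiff M x -> mxdiff u x -> differentiable (fun y => qf (M y) (u y)) x.
Proof.
by move=> dM du; apply: mxdiffM; [apply: mxdiffM => //; exact: mxdiff_tr|].
Qed.

Lemma differentiable_det n (M : V -> 'M[R]_n) x :
  mxdiff M x -> differentiable (fun y => \det (M y)) x.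
Proof.
move=> dM; rewrite /determinant; apply: differentiable_bigsum => s.
apply: differentiableM; first exact: differentiable_cst.
by apply: differentiable_bigprod => i; exact: dM.
Qed.

Lemma mxdiff_adjinv n (M : V -> 'M[R]_n) x :
  mxdiff M x -> \det (M x) != 0 -> mxdiff (fun y => adjinv (M y)) x.
Proof.
move=> dM det0 i j; under eq_fun do rewrite 2!mxE.
apply: differentiableM; first by apply: differentiableV => //; exact: differentiable_det.
rewrite /cofactor; apply: differentiableM; first exact: differentiable_cst.
by apply: differentiable_det => k l; under eq_fun do rewrite !mxE; exact: dM.
Qed.

Lemma differentiable_ln (f : V -> R) x : 0 < f x -> differentiable f x ->
  differentiable (fun y => ln (f y)) x /\
  forall h, 'd (fun y => ln (f y)) x h = (f x)^-1 * 'd f x h.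
Proof. by move=> f0 df; apply: diff_chain => //; exact: is_derive1_ln. Qed.

Lemma near_forall (I : finType) (P : I -> V -> Prop) (x : V) :
  (forall i, \forall y \near x, P i y) -> \forall y \near x, forall i, P i y.
Proof.
move=> nP; suff : \forall y \near x, forall i, i \in enum I -> P i y.
  by apply: filterS => y H i; apply: H; rewrite mem_enum.
elim: (enum I) => [|i s IH]; first by apply: nearW.
apply: filterS2 (nP i) IH => y Pi Ps j; rewrite inE => /orP[/eqP ->//|]; exact: Ps.
Qed.

(** The entry sum [s] gives |u^T B u| <= s(B) |u|^2, and |u|^2 <= c u^T M(x) u for c = s(M(x)^-1),
    by writing |u|^2 as the form of M(x)^-1 at M(x)^(1/2) u. A perturbation with [s] below 1 / (c +
    1) therefore keeps the form positive; the added 1 covers dimension 0, where c = 0. *)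
Lemma posdef_near n (M : V -> 'M[R]_n) x : mxdiff M x ->
  (forall y, (M y)^T = M y) -> posdefmx (M x) -> \forall y \near x, posdefmx (M y).
Proof.
move=> dM symM pM.
pose s (B : 'M[R]_n) := \sum_i \sum_j `|B i j|.
have s_ge0 B : 0 <= s B by do 2!(apply: sumr_ge0 => ? _).
have qf_le B u : `|qf B u| <= s B * qf 1%:M u.
  rewrite qfE /s big_distrl/= (le_trans (ler_norm_sum _ _ _))// ler_sum// => i _.
  rewrite big_distrl/= (le_trans (ler_norm_sum _ _ _))// ler_sum// => j _.
  rewrite normrM ler_wpM2l// qf1 normrM.
  have h k : `|u k 0| ^+ 2 <= \sum_i u i 0 ^+ 2.
    by rewrite real_normK ?num_real// (bigD1 k)//= lerDl sumr_ge0// => l _; exact: sqr_ge0.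
  have := h i; have := h j; set a := `|u i 0|; set b := `|u j 0|.
  by have := sqr_ge0 (a - b); nra.
have [pL LL] := sqrtmxP pM; set L := sqrtmx _ in pL LL.
pose c := s (invmx (M x)).
have qf1_le u : qf 1%:M u <= c * qf (M x) u.
  have -> : qf 1%:M u = qf (invmx (M x)) (L *m u).
    rewrite -qf_congr (posdef_sym pL) -LL invmx_mul ?posdef_unit// !mulmxA.
    by rewrite mulmxV ?posdef_unit// mul1mx mulVmx// posdef_unit.
  apply: le_trans (ler_norm _) _; apply: le_trans (qf_le _ _) _.
  suff -> : qf (M x) u = qf 1%:M (L *m u) by [].
  by rewrite -qf_congr mulmx1 (posdef_sym pL) LL.
have : \forall y \near x, s (M y - M x) < (c + 1)^-1.
  pose d := (c + 1)^-1 / (n * n).+1%:R.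
  have c1 : 0 < (c + 1)^-1 by rewrite invr_gt0 ltr_wpDl// s_ge0.
  have d0 : 0 < d by rewrite divr_gt0.
  have : \forall y \near x, forall i j, `|M y i j - M x i j| < d.
    apply: near_forall => i; apply: near_forall => j.
    by have /differentiable_continuous/cvgr_distC_lt := dM i j; apply.
  apply: filterS => y My; apply: (@le_lt_trans _ _ (\sum_(i < n) \sum_(j < n) d)).
    by do 2!(apply: ler_sum => ? _); rewrite !mxE ltW.
  rewrite !sumr_const !card_ord -mulrnA -mulr_natr /d -mulrA gtr_pMr//.
  by rewrite mulrC ltr_pdivrMr// mul1r ltr_nat.
apply: filterS => y sy; split=> // u u0; rewrite -/(qf _ _).
have q0 := posdef_qf pM u0.
have -> : M y = M x + (M y - M x) by rewrite addrC subrK.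
rewrite qfD -[X in _ + X]opprK subr_gt0 (le_lt_trans (ler_norm _))// normrN.
apply: le_lt_trans (qf_le _ _) _.
apply: (@le_lt_trans _ _ ((c + 1)^-1 * (c * qf (M x) u))).
  by apply: ler_pM => //; [exact: qf1_ge0|exact: ltW].
rewrite mulrA gtr_pMl// mulrC ltr_pdivrMr ?mul1r ?ltrDl//.
by rewrite ltr_wpDl// s_ge0.
Qed.

End mxdiff.

(** Cofactors along row i do not involve that row, so the determinant is affine in a single entry.
    This yields the partial derivatives behind Jacobi's formula [diff_det]. *)
Lemma det_add_delta n (A : 'M[R]_n) i j t :
  \det (t *: delta_mx i j + A) = \det A + t * cofactor A i j.
Proof.
have E k : cofactor (t *: delta_mx i j + A) i k = cofactor A i k.
  rewrite /cofactor; congr (_ * \det _); apply/matrixP => a b.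
  by rewrite !mxE eq_sym (negbTE (neq_lift _ _)) mulr0 add0r.
rewrite !(expand_det_row _ i); under eq_bigr do rewrite E !mxE eqxx mulrDl.
rewrite big_split/= addrC; congr (_ + _).
rewrite (bigD1 j)//= eqxx mulr1 big1 ?addr0// => k kj.
by rewrite (negbTE kj) mulr0 mul0r.
Qed.

Lemma mxdiff_id m n (A : 'M[R]_(m, n)) : mxdiff id A.
Proof. by move=> i j; exact: differentiable_coord. Qed.

Lemma diff_det n (A H : 'M[R]_n) : 'd (fun B : 'M[R]_n => \det B) A H = \tr (\adj A *m H).
Proof.
have dd : differentiable (fun B : 'M[R]_n => \det B) A.
  by apply: (differentiable_det (M := id)); exact: mxdiff_id.
have dE i j : 'd (fun B : 'M[R]_n => \det B) A (delta_mx i j) = cofactor A i j.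
  rewrite -deriveE//; apply: cvg_lim => //.
  apply: cvg_near_cst; near=> t.
  have t0 : t != 0 by near: t; exact: nbhs_dnbhs_neq.
  by rewrite /= det_add_delta addrAC subrr add0r /GRing.scale/= mulKf.
rewrite [H in LHS]matrix_sum_delta raddf_sum/=.
under eq_bigr => i _ do (rewrite raddf_sum/=; under eq_bigr => j _ do rewrite linearZ/= dE).
rewrite mxtrace_mulC /mxtrace; apply: eq_bigr => i _; rewrite mxE.
by apply: eq_bigr => j _; rewrite [\adj A j i]mxE.
Unshelve. all: by end_near. Qed.

(** By the resolvent identity the difference quotient along A + t H equals - A^-1 H (A + t H)^-1 for
    small nonzero t, and this is continuous at t = 0. *)
Lemma derive_adjinv n (A H : 'M[R]_n) i j : A \in unitmx ->
  'd (fun B : 'M[R]_n => adjinv B i j) A H = - (invmx A *m H *m invmx A) i j.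
Proof.
move=> Au; have det0 : \det A != 0 by rewrite -unitfE -unitmxE.
have dd k l : differentiable (fun B : 'M[R]_n => adjinv B k l) A.
  by apply: (mxdiff_adjinv (M := id)) => //; exact: mxdiff_id.
rewrite -deriveE//; apply: cvg_lim => //.
pose B t := adjinv (t *: H + A).
have dline : mxdiff (fun t : R => t *: H + A) 0.
  by apply: mxdiffD; [move=> k l; under eq_fun do rewrite mxE; exact: differentiableM|exact: mxdiff_cst].
have A0 : 0 *: H + A = A by rewrite scale0r add0r.
have dB : mxdiff B 0 by apply: mxdiff_adjinv; rewrite ?A0.
have unear : \forall t \near (0 : R), t *: H + A \in unitmx.
  have : \forall t \near (0 : R), \det (t *: H + A) != 0.
    have /differentiable_continuous cdet := differentiable_det dline.
    by apply: (cvgr_neq0 _ cdet); rewrite A0.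
  by apply: filterS => t; rewrite unitmxE unitfE.
have dC : mxdiff (fun t => - (invmx A *m H *m B t)) 0.
  move=> k l; under eq_fun do rewrite mxE; apply: differentiableN.
  by apply: mxdiffM => //; exact: mxdiff_cst.
rewrite (_ : - (invmx A *m H *m invmx A) i j = (- (invmx A *m H *m B 0)) i j); last first.
  by rewrite [RHS]mxE /B A0 adjinvE.
have /differentiable_continuous/continuous_withinNx H0 := dC i j.
apply: cvg_trans H0; apply: near_eq_cvg; near=> t.
have t0 : t != 0 by near: t; exact: nbhs_dnbhs_neq.
have tu : t *: H + A \in unitmx by near: t; exact: nbhs_dnbhs.
rewrite /= /B !adjinvE//.
set W := invmx (t *: H + A).
have WE : W - invmx A = t *: - (invmx A *m H *m W).
  rewrite scalerN scalemxAl scalemxAr.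
  have -> : t *: H = (t *: H + A) - A by rewrite addrK.
  by rewrite mulmxBr mulmxBl mulVmx// mul1mx -mulmxA mulmxV// mulmx1 opprB.
transitivity ((t^-1 *: (W - invmx A)) i j); last by rewrite !mxE.
by rewrite WE scalerA mulVf// scale1r.
Unshelve. all: by end_near. Qed.

End matrix_calculus.

Section has_differential.
Context (R : realType) (V : normedModType R).
Implicit Types (f g : V -> R) (x h : V).

Definition hasdiff f x (df : V -> R) := differentiable f x /\ forall h, 'd f x h = df h.

Lemma hasdiff_eq f x df dg : hasdiff f x df -> df =1 dg -> hasdiff f x dg.
Proof. by move=> [? H] E; split=> // h; rewrite H E. Qed.

Lemma hasdiff_cst (c : R) x : hasdiff (fun=> c) x (fun=> 0).
Proof.
split; first exact: differentiable_cst.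
by move=> h; rewrite (diff_cst c x).
Qed.

Lemma hasdiffD f g x df dg : hasdiff f x df -> hasdiff g x dg ->
  hasdiff (fun y => f y + g y) x (fun h => df h + dg h).
Proof.
move=> [f1 f2] [g1 g2]; split; first exact: differentiableD.
by move=> h; rewrite -f2 -g2 -[in LHS]/('d (f + g) x h) diffD.
Qed.

Lemma hasdiffM f g x df dg : hasdiff f x df -> hasdiff g x dg ->
  hasdiff (fun y => f y * g y) x (fun h => df h * g x + f x * dg h).
Proof.
move=> [f1 f2] [g1 g2]; split; first exact: differentiableM.
move=> h; rewrite -[in LHS]/('d (f * g) x h) diffM// -f2 -g2 addrC !fctE/=.
by rewrite /GRing.scale/= (mulrC (g x)).
Qed.

Lemma hasdiffZ (c : R) f x df : hasdiff f x df ->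
  hasdiff (fun y => c * f y) x (fun h => c * df h).
Proof.
move=> hf; apply: hasdiff_eq (hasdiffM (hasdiff_cst c x) hf) _ => h.
by rewrite mul0r add0r.
Qed.

Lemma hasdiff_sum (I : Type) (s : seq I) (P : pred I) (f : I -> V -> R) x df :
  (forall i, hasdiff (f i) x (df i)) ->
  hasdiff (fun y => \sum_(i <- s | P i) f i y) x (fun h => \sum_(i <- s | P i) df i h).
Proof.
move=> H; elim: s => [|i s IH].
  rewrite (_ : (fun y => _) = fun=> 0); last by apply/funext => y; rewrite big_nil.
  by apply: hasdiff_eq (hasdiff_cst _ _) _ => h; rewrite big_nil.
rewrite (_ : (fun y => _) = if P i then (fun y => f i y + \sum_(j <- s | P j) f j y)
  else (fun y => \sum_(j <- s | P j) f j y)); last first.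
  by apply/funext => y; rewrite big_cons; case: ifP.
case: ifP => Pi; last by apply: hasdiff_eq IH _ => h; rewrite big_cons Pi.
by apply: hasdiff_eq (hasdiffD (H i) IH) _ => h; rewrite big_cons Pi.
Qed.

Lemma hasdiff_chain (phi : R -> R) f x df (c : R) : is_derive (f x) 1 phi c ->
  hasdiff f x df -> hasdiff (fun y => phi (f y)) x (fun h => c * df h).
Proof.
move=> dphi [f1 f2]; have [c1 c2] := diff_chain dphi f1.
by split=> // h; rewrite -f2 -c2.
Qed.

Lemma hasdiff_linear (f : {linear V -> R}) x : continuous f -> hasdiff f x f.
Proof. by move=> cf; split=> [|h]; [exact: linear_differentiable|rewrite diff_lin]. Qed.

End has_differential.

(** * The gradient in the mean and the symmetrised covariance *)

Section gauss_param_calculus.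
Context (R : realType) (d : nat).
Local Notation E := (gauss_param R d).
Implicit Types (x nu h : E) (F : 'M[R]_d -> R) (C D S : 'M[R]_d) (w v : 'cV[R]_d).

Lemma hasdiff_mean i nu : hasdiff (fun x : E => x.1 i 0) nu (fun h => h.1 i 0).
Proof.
have @f : {linear E -> R}.
  by exists (fun x : E => x.1 i 0); do 2![eexists]; do ?[constructor];
     rewrite ?mxE// => ? *; rewrite ?mxE//; move=> ?; rewrite !mxE.
have cf : continuous f.
  move=> x; apply: (@continuous_comp _ _ _ fst (fun m : 'cV[R]_d => m i 0)).
    exact: cvg_fst.
  exact: coord_continuous.
exact: (hasdiff_linear nu cf).
Qed.

Lemma mxdiff_cov nu : mxdiff (fun x : E => symmx x.2) nu.
Proof.
move=> i j; under eq_fun do rewrite !mxE.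
apply: differentiableM; first exact: differentiable_cst.
have dE k l : differentiable (fun x : E => x.2 k l) nu.
  have @f : {linear E -> R}.
    by exists (fun x : E => x.2 k l); do 2![eexists]; do ?[constructor];
       rewrite ?mxE// => ? *; rewrite ?mxE//; move=> ?; rewrite !mxE.
  have cf : continuous f.
    move=> x; apply: (@continuous_comp _ _ _ snd (fun m : 'M[R]_d => m k l)).
      exact: cvg_snd.
    exact: coord_continuous.
  by have [] := hasdiff_linear nu cf.
by apply: differentiableD.
Qed.

Lemma symmx_sym (X : 'M[R]_d) : (symmx X)^T = symmx X.
Proof. by rewrite /symmx linearZ/= linearD/= trmxK addrC. Qed.

Lemma symmx_id (X : 'M[R]_d) : X^T = X -> symmx X = X.
Proof. by rewrite /symmx => ->; apply/matrixP => i j; rewrite !mxE; field. Qed.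

Lemma symmx_linear (t : R) (X Y : 'M[R]_d) : symmx (t *: X + Y) = t *: symmx X + symmx Y.
Proof.
by apply/matrixP => i j; rewrite !mxE; ring.
Qed.

(** Since [symmx] is linear, the difference quotient of the composite in direction [h] is literally
    that of [F] in direction [symmx h.2]; given differentiability, both differentials are limits of
    the same quotients. *)
Lemma hasdiff_cov F nu dF : differentiable (fun x : E => F (symmx x.2)) nu ->
  hasdiff F (symmx nu.2) dF -> hasdiff (fun x : E => F (symmx x.2)) nu (fun h => dF (symmx h.2)).
Proof.
move=> dFs [dF1 dF2]; split=> // h; rewrite -dF2 -!deriveE// /derive.
rewrite [X in lim (X @ _)](_ : _ = (fun t : R =>
  t^-1 *: ((F \o shift (symmx nu.2)) (t *: symmx h.2) - F (symmx nu.2))))//.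
by apply/funext => t /=; rewrite symmx_linear.
Qed.

(* The expectation of [gpot x] under a law with mean [w] and covariance [C]; the
   adjugate makes it differentiable entry by entry. *)
Definition gexp C w (x : E) : R :=
  2^-1 * (\sum_i \sum_j adjinv (symmx x.2) i j * (C i j + (w - x.1) i 0 * (w - x.1) j 0)
          + ln (\det (symmx x.2))).

Lemma hasdiff_gexp C w nu : posdefmx nu.2 -> C^T = C ->
  hasdiff (gexp C w) nu (fun h =>
    - (h.1^T *m invmx nu.2 *m (w - nu.1)) 0 0 +
    2^-1 * \tr (symmx h.2 *m (invmx nu.2 -
      invmx nu.2 *m (C + (w - nu.1) *m (w - nu.1)^T) *m invmx nu.2))).
Proof.
move=> pS symC; have Su := posdef_unit pS; have Ssym := symmx_id (posdef_sym pS).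
have dS := mxdiff_cov nu.
have det0 : 0 < \det (symmx nu.2) by rewrite Ssym det_posdef.
have dinv i j : hasdiff (fun x : E => adjinv (symmx x.2) i j) nu
    (fun h => - (invmx nu.2 *m symmx h.2 *m invmx nu.2) i j).
  apply: (@hasdiff_cov (fun A => adjinv A i j) nu
    (fun H => - (invmx nu.2 *m H *m invmx nu.2) i j)).
    by apply: mxdiff_adjinv => //; rewrite gt_eqF.
  rewrite Ssym; split.
    by apply: (mxdiff_adjinv (M := id)); [exact: mxdiff_id|rewrite gt_eqF// det_posdef].
  by move=> h; exact: derive_adjinv.
have dw i : hasdiff (fun x : E => (w - x.1) i 0) nu (fun h => - h.1 i 0).
  rewrite (_ : (fun x : E => _) = fun x => w i 0 + (-1) * x.1 i 0); last first.
    by apply/funext => x; rewrite !mxE mulN1r.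
  apply: hasdiff_eq (hasdiffD (hasdiff_cst _ _) (hasdiffZ _ (hasdiff_mean i nu))) _ => h.
  by rewrite add0r mulN1r.
have dln : hasdiff (fun x : E => ln (\det (symmx x.2))) nu
    (fun h => (\det nu.2)^-1 * \tr (\adj nu.2 *m symmx h.2)).
  apply: (@hasdiff_chain _ _ (@ln R) (fun x : E => \det (symmx x.2)) nu
    (fun h => \tr (\adj nu.2 *m symmx h.2))).
    by rewrite Ssym; apply: is_derive1_ln; rewrite det_posdef.
  apply: (@hasdiff_cov (fun A => \det A) nu (fun H => \tr (\adj nu.2 *m H))).
    exact: differentiable_det.
  rewrite Ssym; split; last by move=> h; exact: diff_det.
  by apply: (differentiable_det (M := id)); exact: mxdiff_id.
apply: hasdiff_eq.
  apply: hasdiffZ; apply: hasdiffD dln.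
  apply: hasdiff_sum => i; apply: hasdiff_sum => j.
  apply: hasdiffM (dinv i j) _; apply: hasdiffD (hasdiff_cst _ _) _.
  exact: hasdiffM (dw i) (dw j).
move=> h /=; rewrite Ssym adjinvE//.
set W := invmx nu.2; set u := w - nu.1; set H := symmx h.2.
have symW : W^T = W by rewrite trmx_inv (posdef_sym pS).
have symH : H^T = H by exact: symmx_sym.
have -> : (\det nu.2)^-1 * \tr (\adj nu.2 *m H) = \tr (H *m W).
  rewrite -linearZ/= scalemxAl -/(adjinv nu.2) adjinvE// mxtrace_mulC.
  by [].
rewrite (mulmxBr H W) [\tr (H *m W - _)]raddfB/= (mulrBr 2^-1 (\tr _)).
have trE (X Y : 'M[R]_d) : \tr (X *m Y) = \sum_i \sum_j X i j * Y j i.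
  by rewrite /mxtrace; apply: eq_bigr => i _; rewrite mxE.
have bE (a b : 'cV[R]_d) : (a^T *m W *m b) 0 0 = \sum_i \sum_j W i j * (a i 0 * b j 0).
  rewrite mxE exchange_big/=; apply: eq_bigr => j _.
  by rewrite mxE big_distrl/=; apply: eq_bigr => i _; rewrite mxE; ring.
have -> : \tr (H *m (W *m (C + u *m u^T) *m W)) =
    \sum_i \sum_j (W *m H *m W) i j * (C i j + u i 0 * u j 0).
  rewrite mulmxA mxtrace_mulC !mulmxA trE; apply: eq_bigr => i _; apply: eq_bigr => j _.
  congr (_ * _); rewrite -{1}symC !mxE; congr (_ + _).
  by rewrite big_ord1 !mxE mulrC.
have sE : \sum_i \sum_j W i j * (u i 0 * h.1 j 0) = \sum_i \sum_j W i j * (h.1 i 0 * u j 0).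
  rewrite exchange_big/=; apply: eq_bigr => i _; apply: eq_bigr => j _.
  by rewrite -{1}symW mxE (mulrC (u _ _)).
rewrite bE.
have -> : \sum_i \sum_j (- (W *m H *m W) i j * (C i j + u i 0 * u j 0) +
     W i j * (0 + (- h.1 i 0 * u j 0 + u i 0 * - h.1 j 0))) =
   - (\sum_i \sum_j (W *m H *m W) i j * (C i j + u i 0 * u j 0))
   - \sum_i \sum_j W i j * (h.1 i 0 * u j 0) - \sum_i \sum_j W i j * (u i 0 * h.1 j 0).
  rewrite -!sumrN -!big_split/=; apply: eq_bigr => i _.
  rewrite -!sumrN -!big_split/=; apply: eq_bigr => j _.
  by rewrite -/u; ring.
by rewrite sE; field.
Qed.

(** Test the gradient against itself. The direction (w, 0) gives w^T S^-1 w = 0. The direction (0,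
    G), with G = S^-1 - S^-1 D S^-1 symmetric and hence admissible, gives tr(G^2) = 0, a sum of
    squares of entries. *)
Lemma grad_eq0 S D w : posdefmx S -> D^T = D ->
  (forall (h : 'cV[R]_d) (H : 'M[R]_d), H^T = H ->
    - (h^T *m invmx S *m w) 0 0 +
    2^-1 * \tr (H *m (invmx S - invmx S *m D *m invmx S)) = 0) <->
  w = 0 /\ D = S.
Proof.
move=> pS symD; have Su := posdef_unit pS.
have symW : (invmx S)^T = invmx S by rewrite trmx_inv (posdef_sym pS).
split=> [H0|[-> ->] h H _]; last first.
  by rewrite mulmx0 mulVmx// mul1mx subrr mulmx0 mxtrace0 mulr0 mxE oppr0 addr0.
split.
  have := H0 w 0; rewrite trmx0 mul0mx mxtrace0 mulr0 addr0 => /(_ erefl) /eqP.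
  rewrite oppr_eq0 => q0; apply/eqP/negPn/negP => w0.
  by have := posdef_qf (posdef_inv pS) w0; rewrite /qf (eqP q0) ltxx.
set G := invmx S - _ in H0.
have symG : G^T = G by rewrite /G linearB/= !trmx_mul symW symD mulmxA.
have := H0 0 G symG; rewrite trmx0 !mul0mx mxE oppr0 add0r => /eqP.
rewrite mulf_eq0 invr_eq0 pnatr_eq0/= => trG.
suff G0 : G = 0.
  move/subr0_eq : G0 => /(congr1 (fun X => S *m X *m S)).
  by rewrite !mulmxA mulmxV// mul1mx mulmxKV// mul1mx.
apply/matrixP => i j; rewrite [RHS]mxE; apply/eqP.
move: trG; rewrite -{1}symG mxtrace_mulC /mxtrace => tr0.
have : \sum_i \sum_j G i j ^+ 2 == 0.
  apply: etrans tr0; congr (_ == _); apply: eq_bigr => k _; rewrite mxE.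
  by apply: eq_bigr => l _; rewrite [G^T l k]mxE expr2.
rewrite psumr_eq0 => [/allP/(_ i (mem_index_enum _))|k _]; last first.
  by apply: sumr_ge0 => l _; exact: sqr_ge0.
rewrite /= psumr_eq0 => [/allP/(_ j (mem_index_enum _))|l _]; last exact: sqr_ge0.
by rewrite /= sqrf_eq0.
Qed.

End gauss_param_calculus.

(** * Moments of Gaussian measures *)

Section has_integral.
Context d (T : measurableType d) (R : realType) (p : probability T R).
Implicit Types (f g : T -> R) (a b c : R).

Definition hasint f c := p.-integrable setT (fun x => (f x)%:E) /\ \int[p]_x f x = c.

Lemma hasint_eq f g a b : hasint f a -> f =1 g -> a = b -> hasint g b.
Proof. by move=> H /funext <- <-. Qed.

Lemma hasint_cst c : hasint (fun=> c) c.
Proof.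
split; first exact: finite_measure_integrable_cst.
by rewrite Rintegral_cst// [X in fine X]probability_setT mulr1.
Qed.

Lemma hasintD f g a b : hasint f a -> hasint g b -> hasint (fun x => f x + g x) (a + b).
Proof.
move=> [f1 f2] [g1 g2]; split; last by rewrite RintegralD// f2 g2.
by under eq_fun do rewrite EFinD; exact: integrableD.
Qed.

Lemma hasintZ c f a : hasint f a -> hasint (fun x => c * f x) (c * a).
Proof.
move=> [f1 f2]; split; last by rewrite RintegralZl// f2.
by under eq_fun do rewrite EFinM; exact: integrableZl.
Qed.

Lemma hasintB f g a b : hasint f a -> hasint g b -> hasint (fun x => f x - g x) (a - b).
Proof.
move=> hf /(hasintZ (-1)) hg; apply: hasint_eq (hasintD hf hg) _ _ => [x|]; by rewrite mulN1r.
Qed.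

Lemma hasint_sum (I : Type) (s : seq I) (P : pred I) (f : I -> T -> R) (c : I -> R) :
  (forall i, hasint (f i) (c i)) ->
  hasint (fun x => \sum_(i <- s | P i) f i x) (\sum_(i <- s | P i) c i).
Proof.
move=> H; elim: s => [|i s IH].
  by apply: hasint_eq (hasint_cst 0) _ _ => [x|]; rewrite big_nil.
rewrite big_cons; case: ifP => Pi.
  by apply: hasint_eq (hasintD (H i) IH) _ _ => // x; rewrite big_cons Pi.
by apply: hasint_eq IH _ _ => // x; rewrite big_cons Pi.
Qed.

Lemma le_hasint f g a b : hasint f a -> hasint g b -> (forall x, f x <= g x) -> a <= b.
Proof. by move=> [f1 <-] [g1 <-] fg; apply: le_Rintegral. Qed.

Lemma hasint_EFin f c : hasint f c -> (\int[p]_x (f x)%:E = c%:E)%E.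
Proof. by move=> [f1 <-]; rewrite /Rintegral fineK//; exact: integrable_fin_num. Qed.

End has_integral.

Section gaussian_moments.
Context (R : realType) (d : nat).
Implicit Types (nu r : gauss_param R d) (p : probability (Rtuple R d) R).

Definition mean p : 'cV[R]_d := \col_i \int[p]_x (col_of_tuple x i 0).

Definition cov p : 'M[R]_d :=
  \matrix_(i, j) \int[p]_x (col_of_tuple x i 0 * col_of_tuple x j 0) - mean p *m (mean p)^T.

Lemma cov_sym p : (cov p)^T = cov p.
Proof.
rewrite /cov linearB/= trmx_mul trmxK; congr (_ - _).
apply/matrixP => i j; rewrite !mxE; congr Rintegral; apply/funext => x; exact: mulrC.
Qed.

Lemma hasint_gpot p nu : finite_moment2 p -> posdefmx nu.2 ->
  hasint p (gpot nu) (gexp (cov p) (mean p) nu).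
Proof.
move=> [i1 i2] pS; have Ssym := symmx_id (posdef_sym pS).
rewrite /gpot /gexp Ssym adjinvE ?posdef_unit//.
apply: hasintZ; apply: hasintD (hasint_cst _ _).
rewrite (_ : (fun x => _) = fun x : Rtuple R d => \sum_i \sum_j invmx nu.2 i j *
    ((col_of_tuple x - nu.1) i 0 * (col_of_tuple x - nu.1) j 0)); last first.
  by apply/funext => x; rewrite qfE.
apply: hasint_sum => i; apply: hasint_sum => j; apply: hasintZ.
have subE (u v : 'cV[R]_d) k : (u - v) k 0 = u k 0 - v k 0 by rewrite !mxE.
have covE : cov p i j =
    \int[p]_x (col_of_tuple x i 0 * col_of_tuple x j 0) - mean p i 0 * mean p j 0.
  by rewrite /cov !mxE big_ord1 !mxE.
have h1 k : hasint p (fun x => col_of_tuple x k 0) (mean p k 0).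
  by split; [exact: i1|rewrite mxE].
have h2 : hasint p (fun x => col_of_tuple x i 0 * col_of_tuple x j 0)
    (\int[p]_x (col_of_tuple x i 0 * col_of_tuple x j 0)).
  by split => //; exact: i2.
apply: hasint_eq (hasintD (hasintB (hasintB h2 (hasintZ (nu.1 j 0) (h1 i)))
   (hasintZ (nu.1 i 0) (h1 j))) (hasint_cst _ (nu.1 i 0 * nu.1 j 0))) _ _.
  by move=> x; rewrite !subE; ring.
by rewrite !subE covE; ring.
Qed.

Lemma KL_gaussian r nu : posdefmx r.2 -> posdefmx nu.2 ->
  KL (gaussian r) (gaussian nu) =
  (gexp (cov (gaussian r)) (mean (gaussian r)) nu - gexp (cov (gaussian r)) (mean (gaussian r)) r)%:E.
Proof.
move=> pr pn; have fm := gaussian_finite_moment2 r.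
rewrite (KL_density (gaussian_dominates pr pn) (measurable_gdens r nu) (gdens_gt0 r nu)); last first.
  by move=> A mA; exact: gaussian_density.
apply: hasint_EFin.
apply: hasint_eq (hasintB (hasint_gpot fm pn) (hasint_gpot fm pr)) _ _ => // x.
by rewrite /gdens expRK.
Qed.

(** Gibbs' inequality: 1 + t <= exp t for t the log-density of [nu] relative to [r], integrated
    against [gaussian r], where that density has integral 1. *)
Lemma gexp_min r nu : posdefmx r.2 -> posdefmx nu.2 ->
  gexp (cov (gaussian r)) (mean (gaussian r)) r <= gexp (cov (gaussian r)) (mean (gaussian r)) nu.
Proof.
move=> pr pn; have fm := gaussian_finite_moment2 r.
have h1 : hasint (gaussian r) (gdens nu r) 1.
  have E : (\int[gaussian r]_x (gdens nu r x)%:E = 1)%E.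
    by rewrite -gaussian_density// [LHS]probability_setT.
  split; last by rewrite /Rintegral E.
  apply/integrableP; split; first by apply/measurable_EFinP; exact: measurable_gdens.
  by under eq_integral do rewrite gee0_abs ?lee_fin ?(ltW (gdens_gt0 _ _ _))//; rewrite E ltry.
rewrite -subr_ge0 -(subrr 1).
apply: le_hasint (hasintB (hasint_cst _ 1) h1) (hasintB (hasint_gpot fm pn) (hasint_gpot fm pr)) _.
move=> x; rewrite /gdens; have := expR_ge1Dx (gpot r x - gpot nu x); lra.
Qed.

Lemma gexp_symmx (C : 'M[R]_d) w nu : gexp C w (nu.1, symmx nu.2) = gexp C w nu.
Proof. by rewrite /gexp /= (symmx_id (symmx_sym _)). Qed.

Lemma near_posdef_cov nu : posdefmx nu.2 -> \forall x \near nu, posdefmx (symmx x.2).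
Proof.
move=> pn; apply: posdef_near; first exact: mxdiff_cov.
  by move=> x; exact: symmx_sym.
by rewrite symmx_id// posdef_sym.
Qed.

(* The relative entropy to N(v, Q) is minimal at N(v, Q), so that its
   gradient vanishes there, which identifies the first two moments. *)
Lemma gaussian_moments r : posdefmx r.2 ->
  mean (gaussian r) = r.1 /\ cov (gaussian r) = r.2.
Proof.
move=> pr; set w := mean _; set C := cov _.
have [dg gE] := hasdiff_gexp w pr (cov_sym _ : C^T = C).
have d0 h : 'd (gexp C w) r h = 0.
  have [dg' gE'] : hasdiff (fun x => gexp C w x + - gexp C w r) r ('d (gexp C w) r).
    apply: hasdiff_eq (hasdiffD (conj dg (fun h => erefl)) (hasdiff_cst _ _)) _ => k.
    by rewrite addr0.
  rewrite -gE'; apply: ge0_near_min_diff => //; last by rewrite subrr.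
  apply: filterS (near_posdef_cov pr) => x px.
  by rewrite subr_ge0 -(gexp_symmx _ _ x); exact: gexp_min.
have := (@grad_eq0 R d r.2 (C + (w - r.1) *m (w - r.1)^T) (w - r.1) pr _).1.
case.
- by rewrite linearD/= trmx_mul trmxK cov_sym.
- move=> h H symH; have := d0 (h, H); rewrite gE/= symmx_id//.
- move=> /subr0_eq ->; rewrite subrr mul0mx addr0 => ->; by [].
Qed.

End gaussian_moments.

(** * The optimal pair and the value of the transport problem *)

Section quadratic_identities.
Context (R : realType) (d : nat).
Implicit Types (A B S T : 'M[R]_d) (a b u v w m : 'cV[R]_d) (mu nu r : gauss_param R d).

Lemma qfB A a b : A^T = A -> qf A (a - b) = qf A a - 2 * (a^T *m A *m b) 0 0 + qf A b.
Proof.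
move=> symA; have sym : (b^T *m A *m a) 0 0 = (a^T *m A *m b) 0 0.
  by rewrite -[in LHS](trmxK (b^T *m A *m a)) mxE !trmx_mul trmxK symA mulmxA.
have abE : (a - b)^T = a^T - b^T by apply/matrixP => i j; rewrite !mxE.
have mE (M N : 'M[R]_1) : (M - N) 0 0 = M 0 0 - N 0 0 by rewrite !mxE.
rewrite /qf abE (mulmxBl a^T) mulmxBr (mulmxBl (a^T *m A)) (mulmxBl (a^T *m A)) !mE sym; ring.
Qed.

Lemma qfZr A (c : R) a : qf A (c *: a) = c ^+ 2 * qf A a.
Proof.
rewrite !qfE mulr_sumr; apply: eq_bigr => i _; rewrite mulr_sumr; apply: eq_bigr => j _.
by rewrite !mxE; ring.
Qed.

Lemma sqdistE (x y : Rtuple R d) : sqdist x y = qf 1%:M (col_of_tuple x - col_of_tuple y).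
Proof. by rewrite qf1; apply: eq_bigr => i _; rewrite !mxE. Qed.

Lemma ln_gdens r nu x : ln (gdens r nu x) = gpot nu x - gpot r x.
Proof. exact: expRK. Qed.

Section optimal_pair.
Variables (tau0 tau1 : R) (mu nu : gauss_param R d).
Hypotheses (tau0_gt0 : 0 < tau0) (tau1_gt0 : 0 < tau1)
  (pmu : posdefmx mu.2) (pnu : posdefmx nu.2).

(* [T] is the linear part of the optimal transport map from [r0] to [r1]. *)
Lemma optimal_pair : exists (r0 r1 : gauss_param R d) (T : 'M[R]_d) (m : 'cV[R]_d) (K : R),
  [/\ posdefmx r0.2, posdefmx r1.2, T \in unitmx &
      r1 = (m + T *m r0.1, T *m r0.2 *m T^T)] /\
  (forall x y, K <= sqdist x y + tau0 * ln (gdens r0 mu x) + tau1 * ln (gdens r1 nu y)) /\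
  (forall x, sqdist x (aff m T x) + tau0 * ln (gdens r0 mu x) +
             tau1 * ln (gdens r1 nu (aff m T x)) = K).
Proof.
(* The block condition 1 + (tau0 / 2)(S0^-1 - P^-1) = T reads P^-1 = (S0^-1 + al) - al T, and its
   counterpart for T^-1 reads Q^-1 = (S1^-1 + be) - be T^-1. The shifts al and be also supply the
   bounds that [posdef_riccati] requires. *)
pose al := 2 / tau0; pose be := 2 / tau1.
have al0 : 0 < al by rewrite divr_gt0.
have be0 : 0 < be by rewrite divr_gt0.
pose S0 := mu.2; pose S1 := nu.2.
have pA : posdefmx (invmx S0 + al%:M - al%:M) by rewrite addrK; exact: posdef_inv.
have pB : posdefmx (invmx S1 + be%:M - be%:M) by rewrite addrK; exact: posdef_inv.
have [T [pT pPi PiE]] := posdef_riccati al0 be0 pA pB.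
set Pi := _ - al *: T in pPi PiE.
have Tu := posdef_unit pT; have symT := posdef_sym pT.
have S0u := posdef_unit pmu; have S1u := posdef_unit pnu.
have symW0 := posdef_sym (posdef_inv pmu); have symW1 := posdef_sym (posdef_inv pnu).
pose P := invmx Pi; have pP : posdefmx P by exact: posdef_inv.
pose Q := T *m P *m T.
have pQ : posdefmx Q by rewrite /Q -{1}symT; exact: posdef_congr.
have iQ : invmx Q = invmx S1 + be%:M - be *: invmx T.
  rewrite /Q !invmx_mul ?unitmx_mul ?Tu ?(posdef_unit pP)// /P invmxK PiE.
  rewrite mulmxBl mulmxBr !mulmxA mulVmx// mul1mx mulmxK// -scalemxAr.
  by rewrite mulVmx// -scalemxAl mul1mx.
(* Cancelling the linear terms of the slack forces u = mu.1 - al S0 (u - v) and v = nu.1 + be S1 (u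
   - v). Subtracting, w = u - v solves J w = mu.1 - nu.1. *)
pose J := 1%:M + (al *: S0 + be *: S1).
have Ju : J \in unitmx.
  apply: posdef_unit; apply: posdefD; first exact: posdef1.
  by apply: posdefD; exact: posdefZ.
pose w := invmx J *m (mu.1 - nu.1).
pose u := mu.1 - al *: (S0 *m w); pose v := nu.1 + be *: (S1 *m w).
have uv : u - v = w.
  have Jw : J *m w = mu.1 - nu.1 by rewrite /w mulKVmx.
  have : w + (al *: (S0 *m w) + be *: (S1 *m w)) = mu.1 - nu.1.
    by rewrite -Jw /J !mulmxDl mul1mx -!scalemxAl.
  rewrite /u /v opprD addrACA -opprD => <-.
  by rewrite addrK.
pose c0 := 2^-1 * (al ^+ 2 * qf S0 w + ln (\det S0) - ln (\det P)).
pose c1 := 2^-1 * (be ^+ 2 * qf S1 w + ln (\det S1) - ln (\det Q)).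
pose K := qf 1%:M w + tau0 * c0 + tau1 * c1.
have qS (S : 'M[R]_d) : S \in unitmx -> S^T = S -> qf (invmx S) (S *m w) = qf S w.
  by move=> Su symS; rewrite -qf_congr symS mulmxV// mul1mx.
have E0 x : tau0 * ln (gdens (u, P) mu x) = tau0 * c0 -
    (qf 1%:M (col_of_tuple x - u) - qf T (col_of_tuple x - u)
     + 2 * ((col_of_tuple x - u)^T *m w) 0 0).
  rewrite ln_gdens /gpot/=; set a := col_of_tuple x - u.
  have -> : col_of_tuple x - mu.1 = a - S0 *m (al *: w).
    by rewrite /a /u -scalemxAr opprB addrA addrAC addrK.
  have cr : (a^T *m invmx S0 *m (S0 *m (al *: w))) 0 0 = al * (a^T *m w) 0 0.
    by rewrite mulmxA mulmxKV// -scalemxAr mxE.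
  rewrite qfB// cr.
  have -> : qf (invmx S0) (S0 *m (al *: w)) = al ^+ 2 * qf S0 w.
    by rewrite -scalemxAr qfZr qS// posdef_sym.
  have -> : invmx P = Pi by exact: invmxK.
  rewrite -/S0 /Pi qfD qfN qfZ qfD -(scalemx1 d al) qfZ.
  by rewrite /c0 /al; field; rewrite gt_eqF.
have E1 y : tau1 * ln (gdens (v, Q) nu y) = tau1 * c1 -
    (qf 1%:M (col_of_tuple y - v) - qf (invmx T) (col_of_tuple y - v)
     - 2 * ((col_of_tuple y - v)^T *m w) 0 0).
  rewrite ln_gdens /gpot/=; set a := col_of_tuple y - v.
  have -> : col_of_tuple y - nu.1 = a - S1 *m ((- be) *: w).
    by rewrite /a /v -scalemxAr scaleNr opprK opprD addrA subrK.
  have cr : (a^T *m invmx S1 *m (S1 *m ((- be) *: w))) 0 0 = - be * (a^T *m w) 0 0.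
    by rewrite mulmxA mulmxKV// -scalemxAr mxE.
  rewrite qfB// cr.
  have -> : qf (invmx S1) (S1 *m ((- be) *: w)) = be ^+ 2 * qf S1 w.
    by rewrite -scalemxAr qfZr sqrrN qS// posdef_sym.
  rewrite -/S1 iQ qfD qfN qfZ qfD -(scalemx1 d be) qfZ.
  by rewrite /c1 /be; field; rewrite gt_eqF.
(* In coordinates a, b centred at u, v, the terms linear in w and the squares |a|^2, |b|^2 cancel.
   What is left, a^T T a - 2 a^T b + b^T T^-1 b, is the square of b - T a in the form T^-1. *)
have E x y : sqdist x y + tau0 * ln (gdens (u, P) mu x) + tau1 * ln (gdens (v, Q) nu y) =
    qf (invmx T) ((col_of_tuple y - v) - T *m (col_of_tuple x - u)) + K.
  rewrite E0 E1 sqdistE; set a := col_of_tuple x - u; set b := col_of_tuple y - v.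
  have -> : col_of_tuple x - col_of_tuple y = (a - b) - (- w).
    have shift (X Y U V : 'cV[R]_d) : X - Y = X - U - (Y - V) - - (U - V).
      by apply/matrixP => i j; rewrite !mxE; ring.
    by rewrite -uv; exact: shift.
  have abE : (b^T *m a) 0 0 = (a^T *m b) 0 0.
    by rewrite -[in LHS](trmxK (b^T *m a)) mxE trmx_mul trmxK.
  have wNE c : ((c : 'cV[R]_d)^T *m 1%:M *m - w) 0 0 = - (c^T *m w) 0 0.
    by rewrite mulmx1 mulmxN mxE.
  have qw : qf 1%:M (- w) = qf 1%:M w.
    by rewrite -scaleN1r qfZr sqrrN expr1n mul1r.
  have abw : ((a - b)^T *m w) 0 0 = (a^T *m w) 0 0 - (b^T *m w) 0 0.
    by rewrite (_ : (a - b)^T = a^T - b^T) ?mulmxBl ?mxE//; apply/matrixP => i j; rewrite !mxE.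
  have qT : qf (invmx T) (T *m a) = qf T a.
    by rewrite -qf_congr symT mulmxV// mul1mx.
  have symI := posdef_sym (posdef1 R d); have symiT := posdef_sym (posdef_inv pT).
  rewrite (qfB (a - b) (- w) symI) wNE qw abw (qfB a b symI) (qfB b (T *m a) symiT) qT mulmx1.
  by rewrite mulmxA mulmxKV// abE /K; ring.
exists (u, P), (v, Q), T, (v - T *m u), K; split; first split => //.
  by rewrite symT subrK.
split=> [x y|x].
  by rewrite E lerDr posdef_qf_ge0//; exact: posdef_inv.
have shift (V A B : 'cV[R]_d) : V - A + B - V - (B - A) = 0.
  by apply/matrixP => i j; rewrite !mxE; ring.
rewrite E /aff tuple_of_colK (mulmxBr T (col_of_tuple x) u) shift.
by rewrite /qf mulmx0 mxE add0r.
Qed.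

End optimal_pair.

End quadratic_identities.

Section transport_value.
Context (R : realType) (d : nat).
Implicit Types (mu nu r : gauss_param R d).

Definition graph_aff (m : 'cV[R]_d) (T : 'M[R]_d) (x : Rtuple R d) := (x, aff m T x).

Lemma measurable_graph_aff m T : measurable_fun setT (graph_aff m T).
Proof. by apply/measurable_fun_pair => //; exact: measurable_aff. Qed.

HB.instance Definition _ m T :=
  isMeasurableFun.Build _ _ _ _ (graph_aff m T) (measurable_graph_aff m T).

Lemma integral_gdens r nu : posdefmx r.2 -> posdefmx nu.2 ->
  (\int[gaussian nu]_x (gdens r nu x)%:E = 1)%E.
Proof. by move=> pr pn; rewrite -gaussian_density// [LHS]probability_setT. Qed.

Lemma hasint_ln_gdens r nu : posdefmx r.2 -> posdefmx nu.2 ->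
  exists2 c, hasint (gaussian r) (fun x => ln (gdens r nu x)) c &
             KL (gaussian r) (gaussian nu) = c%:E.
Proof.
move=> pr pn; have fm := gaussian_finite_moment2 r.
eexists; last exact: KL_gaussian.
apply: hasint_eq (hasintB (hasint_gpot fm pn) (hasint_gpot fm pr)) _ _ => // x.
by rewrite ln_gdens.
Qed.

Lemma gaussian_aff r m T (A : set (Rtuple R d)) : posdefmx r.2 -> T \in unitmx ->
  measurable A ->
  gaussian r (aff m T @^-1` A) = gaussian (m + T *m r.1, T *m r.2 *m T^T) A.
Proof.
move=> pr Tu mA.
have mB : measurable (aff m T @^-1` A).
  by rewrite -[X in measurable X]setTI; exact: measurable_aff.
have indE (p : probability (Rtuple R d) R) B : measurable B ->
    (\int[p]_x (\1_B x)%:E = p B)%E.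
  by move=> mB'; rewrite integral_indic// setIT.
rewrite -!indE// -(ge0_integral_gaussian_aff m pr Tu)//.
by apply/measurable_EFinP; exact: measurable_indic.
Qed.

Section cost.
Variables (tau0 tau1 : R).
Hypotheses (tau0_gt0 : 0 < tau0) (tau1_gt0 : 0 < tau1).
Local Open Scope ereal_scope.

Lemma cost_ge mu nu r0 r1 (K : R) : posdefmx mu.2 -> posdefmx nu.2 ->
    posdefmx r0.2 -> posdefmx r1.2 ->
    (forall x y, K <= sqdist x y + tau0 * ln (gdens r0 mu x) + tau1 * ln (gdens r1 nu y))%R ->
  forall p q, K%:E <= UOT_cost tau0 tau1 mu nu p q.
Proof.
move=> pm pn p0 p1 HK p q; rewrite /UOT_cost.
apply: (@dual_bound R d tau0 tau1 _ _ p q (gdens r0 mu) (gdens r1 nu)) => //.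
- exact: measurable_gdens.
- exact: measurable_gdens.
- exact: gdens_gt0.
- exact: gdens_gt0.
- by rewrite integral_gdens.
- by rewrite integral_gdens.
Qed.

(** On the graph the squared distance equals [K] minus the weighted log-densities, so its integral
    under the graph coupling is [K] minus the weighted entropies. The total is [K] without
    evaluating any of these integrals. *)
Lemma cost_aff mu nu r0 r1 T m (K : R) : posdefmx mu.2 -> posdefmx nu.2 ->
    posdefmx r0.2 -> posdefmx r1.2 -> T \in unitmx ->
    r1 = (m + T *m r0.1, T *m r0.2 *m T^T)%R ->
    (forall x, sqdist x (aff m T x) + tau0 * ln (gdens r0 mu x) +
               tau1 * ln (gdens r1 nu (aff m T x)) = K)%R ->
  UOT_cost tau0 tau1 mu nu (gaussian r0) (gaussian r1) <= K%:E.
Proof.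
move=> pm pn p0 p1 Tu r1E HK.
have [k0 h0 K0] := hasint_ln_gdens p0 pm; have [k1 h1 K1] := hasint_ln_gdens p1 pn.
have img A : measurable A -> gaussian r0 (aff m T @^-1` A) = gaussian r1 A.
  by rewrite r1E; exact: gaussian_aff.
have h1' : hasint (gaussian r0) (fun x => ln (gdens r1 nu (aff m T x))) k1.
  have [i1 E1] := h1; split.
    exact: (integrable_image (@measurable_aff R d m T) img i1).
  rewrite -E1; congr fine.
  by apply: (integral_image (@measurable_aff R d m T) img (measurable_int _ i1)).
have hs : hasint (gaussian r0) (fun x => sqdist x (aff m T x)) (K - tau0 * k0 - tau1 * k1)%R.
  apply: hasint_eq (hasintB (hasintB (hasint_cst _ K) (hasintZ tau0 h0)) (hasintZ tau1 h1')) _ _ => //.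
  by move=> x /=; rewrite -(HK x); ring.
pose pi := distribution (gaussian r0) (graph_aff m T).
have piE : couplings (gaussian r0) (gaussian r1) pi.
  move=> A mA; split.
    rewrite /pi /distribution/= /pushforward/=; congr (gaussian r0 _).
    by apply/seteqP; split=> [x []|x ?].
  rewrite -img// /pi /distribution/= /pushforward/=; congr (gaussian r0 _).
  by apply/seteqP; split=> [x []|x ?].
have -> : K%:E = (K - tau0 * k0 - tau1 * k1)%:E + tau0%:E * k0%:E + tau1%:E * k1%:E.
  by rewrite -!EFinM -!EFinD; congr EFin; ring.
rewrite /UOT_cost K0 K1; apply: leeD => //; apply: leeD => //.
apply: ereal_inf_lbound; exists pi => //.
rewrite -(hasint_EFin hs).
rewrite -(@ge0_integral_image _ _ _ _ R (graph_aff m T) (gaussian r0) pi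
  (measurable_graph_aff m T) _ (fun z => (sqdist z.1 z.2)%:E))//.
- by apply/measurable_EFinP; exact: measurable_sqdist.
- by move=> y; rewrite lee_fin sqdist_ge0.
Qed.

(** The explicit pair attains the dual value, so the infimum is squeezed. The pointwise dual
    inequality stays in the conclusion because it is later perturbed to bound the cost from below
    near [nu]. *)
Lemma UOT_attained mu nu : posdefmx mu.2 -> posdefmx nu.2 ->
  exists r0 r1, [/\ posdefmx r0.2, posdefmx r1.2,
    UOT_cost tau0 tau1 mu nu (gaussian r0) (gaussian r1) = (UOT tau0 tau1 mu nu)%:E,
    forall p q, (UOT tau0 tau1 mu nu)%:E <= UOT_cost tau0 tau1 mu nu p q &
    forall x y, (UOT tau0 tau1 mu nu <=
      sqdist x y + tau0 * ln (gdens r0 mu x) + tau1 * ln (gdens r1 nu y))%R].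
Proof.
move=> pm pn.
have [r0 [r1 [T [m [K [[p0 p1 Tu r1E] [HK KE]]]]]]] := optimal_pair tau0_gt0 tau1_gt0 pm pn.
have cge := cost_ge pm pn p0 p1 HK.
have cE : UOT_cost tau0 tau1 mu nu (gaussian r0) (gaussian r1) = K%:E.
  by apply/eqP; rewrite eq_le cge andbT; exact: cost_aff KE.
have UE : UOT tau0 tau1 mu nu = K.
  rewrite /UOT (_ : ereal_inf _ = K%:E)//; apply/eqP; rewrite eq_le; apply/andP; split.
    by apply: ereal_inf_lbound; exists (gaussian r0 : probability _ R, gaussian r1 : probability _ R).
  by apply: le_ereal_inf_tmp => _ [[p q] _ <-]; exact: cge.
by exists r0, r1; rewrite UE.
Qed.

(** The explicit pair shows that the set defining the adjusted target is inhabited, so [get] returns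
    a genuine optimal second component rather than a default value. *)
Lemma adjusted_targetP mu nu : posdefmx mu.2 -> posdefmx nu.2 ->
  posdefmx (adjusted_target tau0 tau1 mu nu).2 /\
  exists p, UOT_cost tau0 tau1 mu nu p (gaussian (adjusted_target tau0 tau1 mu nu)) =
            (UOT tau0 tau1 mu nu)%:E.
Proof.
move=> pm pn; have [r0 [r1 [p0 p1 cE cge _]]] := UOT_attained pm pn.
have : exists r, [set r : gauss_param R d | nondeg_gaussian r /\
    exists p, UOT_minimizer tau0 tau1 mu nu p (gaussian r)] r.
  by exists r1; split=> //; exists (gaussian r0) => p q; rewrite cE.
move=> /getPex; rewrite -/(adjusted_target _ _ _ _) => -[pr [p pmin]].
split=> //; exists p; apply/eqP; rewrite eq_le cge andbT -cE; exact: pmin.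
Qed.

Lemma UOT_ge mu nu r0 r1 (K : R) : posdefmx mu.2 -> posdefmx nu.2 ->
    posdefmx r0.2 -> posdefmx r1.2 ->
    (forall x y, K <= sqdist x y + tau0 * ln (gdens r0 mu x) + tau1 * ln (gdens r1 nu y))%R ->
  (K <= UOT tau0 tau1 mu nu)%R.
Proof.
move=> pm pn p0 p1 HK; have [s0 [s1 [_ _ cE _ _]]] := UOT_attained pm pn.
by rewrite -lee_fin -cE; exact: cost_ge HK _ _.
Qed.

Lemma UOT_le mu nu nu' p r : posdefmx mu.2 -> posdefmx nu.2 -> posdefmx nu'.2 ->
    posdefmx r.2 -> UOT_cost tau0 tau1 mu nu p (gaussian r) = (UOT tau0 tau1 mu nu)%:E ->
  (UOT tau0 tau1 mu nu' <= UOT tau0 tau1 mu nu +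
    tau1 * (gexp r.2 r.1 nu' - gexp r.2 r.1 nu))%R.
Proof.
move=> pm pn pn' pr cE.
have [s0 [s1 [_ _ _ /(_ p (gaussian r)) cge _]]] := UOT_attained pm pn'.
move: cE cge; rewrite /UOT_cost (KL_gaussian pr pn) (KL_gaussian pr pn').
have [-> ->] := gaussian_moments pr; rewrite -!EFinM.
(* The total cost is finite, so transport cost plus first entropy is a real number [W]. It is the
   same for [nu] and [nu'] and cancels, leaving the difference of the second entropies. *)
case: (W2sq _ _ + _) => [W| |]//=; rewrite -!EFinD lee_fin => -[<-] H.
by apply: le_trans H _; rewrite le_eqVlt; apply/orP; left; apply/eqP; ring.
Qed.

End cost.

End transport_value.

(** * The differential of the transport cost *)

Section transport_differential.
Context (R : realType) (d : nat).
Implicit Types (mu nu r x : gauss_param R d).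
Notation E := (gauss_param R d).

Lemma qfDr (A : 'M[R]_d) (a b : 'cV[R]_d) : A^T = A ->
  qf A (a + b) = qf A a + 2 * (a^T *m A *m b) 0 0 + qf A b.
Proof.
move=> symA; rewrite -[b in LHS]opprK qfB// -(scaleN1r b) qfZr -scalemxAr mxE; ring.
Qed.

(** Keeping the density of [r] relative to [nu] but using [x] as reference gives the potential gpot
    x - gpot nu + gpot r. This is its Hessian, [shift_vec] is minus its gradient at [r.1], and
    [shift_cst] is minus the logarithm of the integral of [gdens r nu] against N(x), when this
    Hessian is positive definite. *)
Definition shift_prec nu r x : 'M[R]_d :=
  adjinv (symmx x.2) - invmx nu.2 + invmx r.2.

Definition shift_vec nu r x : 'cV[R]_d :=
  invmx nu.2 *m (r.1 - nu.1) - adjinv (symmx x.2) *m (r.1 - x.1).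

Definition shift_cst nu r x : R :=
  2^-1 * (qf (adjinv (symmx x.2)) (r.1 - x.1) + ln (\det (symmx x.2))
          - qf (adjinv (shift_prec nu r x)) (shift_vec nu r x) + ln (\det (shift_prec nu r x))
          - (qf (invmx nu.2) (r.1 - nu.1) + ln (\det nu.2) - ln (\det r.2))).

Definition shift_param nu r x : E :=
  (r.1 + invmx (shift_prec nu r x) *m shift_vec nu r x, invmx (shift_prec nu r x)).

Lemma ln_det_inv (A : 'M[R]_d) : posdefmx A -> ln (\det (invmx A)) = - ln (\det A).
Proof. by move=> pA; rewrite det_inv lnV// posrE det_posdef. Qed.

(* Completing the square: the density ratio of [r] with respect to [nu], up to
   the factor [exp (shift_cst nu r x)], is that of [shift_param nu r x] with
   respect to [x]. *)
Lemma ln_gdens_shift nu r x y : posdefmx nu.2 -> posdefmx r.2 ->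
    posdefmx (symmx x.2) -> posdefmx (shift_prec nu r x) ->
  ln (gdens (shift_param nu r x) (x.1, symmx x.2) y) = ln (gdens r nu y) + shift_cst nu r x.
Proof.
move=> pn pr px; set H := shift_prec nu r x => pH.
have symN := posdef_sym (posdef_inv pn).
have symN' := posdef_sym (posdef_inv px); have symH := posdef_sym pH.
have Hu := posdef_unit pH.
set e := shift_vec nu r x.
rewrite !ln_gdens /gpot /shift_cst /shift_param -/H -/e /=.
rewrite invmxK (ln_det_inv pH) !adjinvE ?posdef_unit//.
set a := col_of_tuple y - r.1.
have E1 (u : 'cV[R]_d) : col_of_tuple y - u = a + (r.1 - u) by rewrite /a addrA subrK.
have E2 (z : 'cV[R]_d) : col_of_tuple y - (r.1 + z) = a - z by rewrite opprD addrA.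
rewrite (E1 nu.1) (E1 x.1) E2.
rewrite (qfB a (invmx H *m e) symH) (qfDr a (r.1 - nu.1) symN) (qfDr a (r.1 - x.1) symN').
have -> : (a^T *m H *m (invmx H *m e)) 0 0 = (a^T *m e) 0 0 by rewrite mulmxA mulmxK.
have -> : qf H (invmx H *m e) = qf (invmx H) e.
  by rewrite -qf_congr (posdef_sym (posdef_inv pH)) mulVmx// mul1mx.
have -> : qf H a = qf (invmx (symmx x.2)) a - qf (invmx nu.2) a + qf (invmx r.2) a.
  by rewrite /H /shift_prec adjinvE ?posdef_unit// qfD qfD qfN.
have -> : (a^T *m e) 0 0 = (a^T *m invmx nu.2 *m (r.1 - nu.1)) 0 0
    - (a^T *m invmx (symmx x.2) *m (r.1 - x.1)) 0 0.
  rewrite /e /shift_vec adjinvE ?posdef_unit// (mulmxBr a^T) !mulmxA.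
  by rewrite [LHS]mxE [X in _ + X]mxE.
by lra.
Qed.

Lemma shift_prec_id nu r : posdefmx nu.2 -> shift_prec nu r nu = invmx r.2.
Proof.
move=> pn; rewrite /shift_prec symmx_id ?posdef_sym// adjinvE ?posdef_unit//.
by rewrite subrr add0r.
Qed.

Lemma shift_cst_id nu r : posdefmx nu.2 -> posdefmx r.2 -> shift_cst nu r nu = 0.
Proof.
move=> pn pr; rewrite /shift_cst shift_prec_id// /shift_vec symmx_id ?posdef_sym//.
rewrite !adjinvE ?posdef_unit//; last exact: posdef_inv.
have q0 (A : 'M[R]_d) : qf A 0 = 0 by rewrite /qf mulmx0 mxE.
by rewrite (subrr (invmx nu.2 *m _)) q0 ln_det_inv//; lra.
Qed.

Lemma mxdiff_mean nu : mxdiff (fun x : E => x.1) nu.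
Proof.
by move=> i j; rewrite (ord1 j); exact: (hasdiff_mean i nu).1.
Qed.

Lemma mxdiff_shift_prec nu r : posdefmx nu.2 -> mxdiff (shift_prec nu r) nu.
Proof.
move=> pn; apply: mxdiffD (mxdiff_cst _ _); apply: mxdiffB (mxdiff_cst _ _).
apply: mxdiff_adjinv; first exact: mxdiff_cov.
by rewrite symmx_id ?posdef_sym// gt_eqF// det_posdef.
Qed.

Lemma differentiable_shift_cst nu r : posdefmx nu.2 -> posdefmx r.2 ->
  differentiable (shift_cst nu r) nu.
Proof.
move=> pn pr.
have ds : mxdiff (fun x : E => adjinv (symmx x.2)) nu.
  apply: mxdiff_adjinv; first exact: mxdiff_cov.
  by rewrite symmx_id ?posdef_sym// gt_eqF// det_posdef.
have dm : mxdiff (fun x : E => r.1 - x.1) nu.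
  by apply: mxdiffB (mxdiff_cst _ _) (mxdiff_mean _).
have dH := mxdiff_shift_prec r pn.
have H0 : 0 < \det (shift_prec nu r nu).
  by rewrite shift_prec_id// det_posdef//; exact: posdef_inv.
apply: differentiableM; first exact: differentiable_cst.
apply: differentiableB; last exact: differentiable_cst.
apply: differentiableD.
  apply: differentiableB; first apply: differentiableD.
  - exact: differentiable_qf.
  - apply: (differentiable_ln _ _).1.
      by rewrite symmx_id ?posdef_sym// det_posdef.
    by apply: differentiable_det; exact: mxdiff_cov.
  - apply: differentiable_qf; first by apply: mxdiff_adjinv => //; rewrite gt_eqF.
    by apply: mxdiffB (mxdiff_cst _ _) _; exact: mxdiffM.
by apply: (differentiable_ln _ _).1 => //; exact: differentiable_det.
Qed.

Lemma near_posdef_shift_prec nu r : posdefmx nu.2 -> posdefmx r.2 ->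
  \forall x \near nu, posdefmx (shift_prec nu r x).
Proof.
move=> pn pr.
have adj_sym (A : 'M[R]_d) : A^T = A -> (adjinv A)^T = adjinv A.
  by move=> symA; rewrite /adjinv linearZ/= trmx_adj symA.
apply: posdef_near; first exact: mxdiff_shift_prec.
  move=> x; rewrite /shift_prec linearD/= linearB/= adj_sym ?symmx_sym//.
  by rewrite (posdef_sym (posdef_inv pn)) (posdef_sym (posdef_inv pr)).
by rewrite shift_prec_id//; exact: posdef_inv.
Qed.

(** The majorant [U] involves the selected target [r], the minorant [L] the component [r1] of the
    explicit pair. The differential is read off [U]; [L] only has to be differentiable and touch at
    [nu]. *)
Lemma hasdiff_UOT (tau0 tau1 : R) mu nu : 0 < tau0 -> 0 < tau1 ->
    posdefmx mu.2 -> posdefmx nu.2 ->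
  let r := adjusted_target tau0 tau1 mu nu in
  hasdiff (fun x : E => UOT tau0 tau1 mu (x.1, symmx x.2)) nu
    (fun h => tau1 * 'd (gexp r.2 r.1) nu h).
Proof.
move=> t0 t1 pm pn r.
have [pr [p cE]] := adjusted_targetP t0 t1 pm pn; rewrite -/r in pr cE.
have [r0 [r1 [p0 p1 _ _ HK]]] := UOT_attained t0 t1 pm pn.
have nuE : (nu.1, symmx nu.2) = nu by case: (nu) pn => m S /= pS; rewrite symmx_id// posdef_sym.
pose L x := UOT tau0 tau1 mu nu + tau1 * shift_cst nu r1 x.
pose U x := UOT tau0 tau1 mu nu + tau1 * (gexp r.2 r.1 x - gexp r.2 r.1 nu).
have [dg _] := hasdiff_gexp r.1 pn (posdef_sym pr).
have hU : hasdiff U nu (fun h => tau1 * 'd (gexp r.2 r.1) nu h).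
  apply: hasdiff_eq (hasdiffD (hasdiff_cst _ _) (hasdiffZ tau1
    (hasdiffD (conj dg (fun h => erefl)) (hasdiff_cst (- gexp r.2 r.1 nu) _)))) _ => h.
  by rewrite add0r addr0.
have dL : differentiable L nu.
  apply: differentiableD; first exact: differentiable_cst.
  by apply: differentiableM; [exact: differentiable_cst|exact: differentiable_shift_cst].
have [|||d1 d2] := @sandwich_diff R _ (fun x : E => UOT tau0 tau1 mu (x.1, symmx x.2))
    L U nu _ _ _ dL hU.1.
- apply: filterS2 (near_posdef_cov pn) (near_posdef_shift_prec pn p1) => x px pH.
  have px' : posdefmx ((x.1, symmx x.2) : E).2 by [].
  apply/andP; split; last first.
    by apply: le_trans (UOT_le t0 t1 pm pn px' pr cE) _; rewrite gexp_symmx.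
  apply: (UOT_ge t0 t1 pm px' p0 (r1 := shift_param nu r1 x)); first exact: posdef_inv.
  move=> y z; rewrite ln_gdens_shift// mulrDr addrA lerD2r; exact: HK.
- by rewrite /L shift_cst_id// mulr0 addr0 nuE.
- by rewrite /U subrr mulr0 addr0 nuE.
- split=> // h; rewrite d2; exact: hU.2.
Qed.

End transport_differential.

(** * The barycenter functional *)

Section differential_exp.
Context (R : realType) (V : normedModType R).
Implicit Types (f : V -> R) (x : V).

Lemma hasdiff_expR f x df : hasdiff f x df ->
  hasdiff (fun y => expR (f y)) x (fun h => expR (f x) * df h).
Proof. by move=> hf; apply: hasdiff_chain hf; exact: is_derive_expR. Qed.

Lemma hasdiff_powR (p : R) f x df : 0 < f x -> hasdiff f x df ->
  hasdiff (fun y => f y `^ p) x (fun h => p * f x `^ (p - 1) * df h).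
Proof.
by move=> f0 hf; apply: (hasdiff_chain (phi := fun t => t `^ p)) hf; exact: is_derive1_powR.
Qed.

Lemma hasdiff_sum_exp (I : finType) (c : I -> R) (s : R) (f : I -> V -> R) x df :
  (forall i, hasdiff (f i) x (df i)) ->
  hasdiff (fun y => \sum_i c i * expR (- f i y / s)) x
    (fun h => - s^-1 * \sum_i c i * expR (- f i x / s) * df i h).
Proof.
move=> hf; have hl i : hasdiff (fun y => - f i y / s) x (fun h => - s^-1 * df i h).
  rewrite (_ : (fun y => _) = fun y => - s^-1 * f i y); first exact: hasdiffZ.
  by apply/funext => y; rewrite mulNr mulrC mulNr.
apply: hasdiff_eq (hasdiff_sum _ _ (fun i => hasdiffZ (c i) (hasdiff_expR (hl i)))) _ => h.
by rewrite mulr_sumr; apply: eq_bigr => i _; ring.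
Qed.

End differential_exp.

Section barycenter.
Context (R : realType) (d n : nat).
Variables (tau0 tau1 : R) (lam a : 'I_n -> R) (mu : 'I_n -> gauss_param R d).
Hypotheses (tau0_gt0 : 0 < tau0) (tau1_gt0 : 0 < tau1) (n_ge1 : (1 <= n)%N)
  (lam_gt0 : forall i, 0 < lam i) (a_gt0 : forall i, 0 < a i)
  (mu_nondeg : forall i, nondeg_gaussian (mu i)).
Notation E := (gauss_param R d).
Notation s := (tau0 + tau1).
Notation theta := (tau0 / s).
Notation Z := (Zsum tau0 tau1 lam a mu).
Notation w := (omega tau0 tau1 lam a mu).
Notation v := (adj_mean tau0 tau1 mu).
Notation Q := (adj_cov tau0 tau1 mu).

Let s_gt0 : 0 < s. Proof. exact: addr_gt0. Qed.
Let theta_gt0 : 0 < theta. Proof. exact: divr_gt0. Qed.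

Lemma Zsum_gt0 nu : 0 < Z nu.
Proof.
have t_gt0 i : 0 < lam i * a i `^ theta * expR (- Acost tau0 tau1 mu i nu / s).
  by rewrite !mulr_gt0 ?powR_gt0 ?expR_gt0.
rewrite /Zsum (bigD1 (Ordinal n_ge1))//= ltr_pwDl//.
by apply: sumr_ge0 => i _; exact: ltW.
Qed.

Lemma omega_sum1 nu : \sum_i w i nu = 1.
Proof. by rewrite -mulr_suml divff// gt_eqF// Zsum_gt0. Qed.

(** Since b = Z^(1 / theta), one has Z = b^theta. Each lam i * M i is the i-th term of Z times b^(1
    - theta), so the sum is b^theta b^(1 - theta) = b, and dividing by b recovers the normalised
    weights. *)
Lemma bstarE nu : bstar tau0 tau1 lam a mu nu = \sum_i lam i * Mstar tau0 tau1 lam a mu i nu /\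
  forall i, w i nu = lam i * Mstar tau0 tau1 lam a mu i nu / bstar tau0 tau1 lam a mu nu.
Proof.
set b := bstar _ _ _ _ _ nu; have b_gt0 : 0 < b by exact/powR_gt0/Zsum_gt0.
have ZE : Z nu = b `^ theta.
  by rewrite -powRrM mulVf ?gt_eqF// powRr1// ltW// Zsum_gt0.
have bE : b `^ theta * b `^ (1 - theta) = b.
  have e1 : theta + (1 - theta) = 1 by rewrite addrC subrK.
  by rewrite -powRD e1 ?powRr1 ?ltW// (gt_eqF b_gt0) implybT.
have ME i : lam i * Mstar tau0 tau1 lam a mu i nu =
    lam i * a i `^ theta * expR (- Acost tau0 tau1 mu i nu / s) * b `^ (1 - theta).
  by rewrite /Mstar -/b; ring.
split; first by under eq_bigr do rewrite ME; rewrite -mulr_suml -/(Z nu) ZE bE.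
move=> i; have -> : w i nu = lam i * a i `^ theta * expR (- Acost tau0 tau1 mu i nu / s) / Z nu by [].
have -> : b^-1 = (b `^ theta * b `^ (1 - theta))^-1 by rewrite bE.
by rewrite ME ZE; field; rewrite !gt_eqF// powR_gt0.
Qed.

(** The second moment of the mixture of the q_i about [nu.1], not about the mixture mean. This
    centring is what the gradients of the entropies produce. *)
Definition devmx nu : 'M[R]_d :=
  \sum_i w i nu *: (Q i nu + (v i nu - nu.1) *m (v i nu - nu.1)^T).

Let hasdiff_Acost i nu : posdefmx nu.2 ->
  hasdiff (fun x : E => Acost tau0 tau1 mu i (x.1, symmx x.2)) nu (fun h =>
    tau1 * (- (h.1^T *m invmx nu.2 *m (v i nu - nu.1)) 0 0 +
    2^-1 * \tr (symmx h.2 *m (invmx nu.2 - invmx nu.2 *m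
      (Q i nu + (v i nu - nu.1) *m (v i nu - nu.1)^T) *m invmx nu.2)))).
Proof.
move=> pn; have [pr _] := adjusted_targetP tau0_gt0 tau1_gt0 (mu_nondeg i) pn.
apply: hasdiff_eq (hasdiff_UOT tau0_gt0 tau1_gt0 (mu_nondeg i) pn) _ => h.
by rewrite (hasdiff_gexp _ pn (posdef_sym pr)).2.
Qed.

Let grad i nu (h : E) : R := - (h.1^T *m invmx nu.2 *m (v i nu - nu.1)) 0 0 +
    2^-1 * \tr (symmx h.2 *m (invmx nu.2 - invmx nu.2 *m
      (Q i nu + (v i nu - nu.1) *m (v i nu - nu.1)^T) *m invmx nu.2)).

(** The gradient is affine in the mean and in the centred second moment of the target, so averaging
    with weights of sum 1 passes to these moments of the mixture. *)
Let sum_grad nu (h : E) : \sum_i w i nu * grad i nu h =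
    - (h.1^T *m invmx nu.2 *m (\sum_i w i nu *: v i nu - nu.1)) 0 0 +
    2^-1 * \tr (symmx h.2 *m (invmx nu.2 - invmx nu.2 *m devmx nu *m invmx nu.2)).
Proof.
set N := invmx nu.2; set H := symmx h.2.
have -> : \sum_i w i nu *: v i nu - nu.1 = \sum_i w i nu *: (v i nu - nu.1).
  rewrite -[X in _ - X]scale1r -(omega_sum1 nu) scaler_suml -sumrB.
  by apply: eq_bigr => i _; rewrite scalerBr.
have -> : N - N *m devmx nu *m N = \sum_i w i nu *: (N - N *m
    (Q i nu + (v i nu - nu.1) *m (v i nu - nu.1)^T) *m N).
  rewrite -[X in X - _]scale1r -(omega_sum1 nu) scaler_suml /devmx mulmx_sumr mulmx_suml -sumrB.
  by apply: eq_bigr => i _; rewrite scalerBr -scalemxAr -scalemxAl.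
rewrite !mulmx_sumr summxE -sumrN [\tr _]raddf_sum mulr_sumr -big_split/=.
have sE (t : R) (M : 'M[R]_1) : (t *: M) 0 0 = t * M 0 0 by rewrite mxE.
by apply: eq_bigr => i _; rewrite /grad -/N -/H -!scalemxAr sE mxtraceZ; ring.
Qed.

(** The chain rule weights the i-th cost gradient by its term of Z; dividing by Z turns these
    weights into omega. All other factors are positive and collect in [c], so only its nonvanishing
    is recorded. *)
Lemma hasdiff_Phi nu : posdefmx nu.2 ->
  exists2 c : R, c != 0 &
  hasdiff (fun x : E => Phi tau0 tau1 lam a mu (x.1, symmx x.2)) nu (fun h =>
    c * (- (h.1^T *m invmx nu.2 *m (\sum_i w i nu *: v i nu - nu.1)) 0 0 +
    2^-1 * \tr (symmx h.2 *m (invmx nu.2 - invmx nu.2 *m devmx nu *m invmx nu.2)))).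
Proof.
move=> pn; have Z0 := Zsum_gt0 nu.
have nuE : (nu.1, symmx nu.2) = nu by case: (nu) pn => m S /= pS; rewrite symmx_id// posdef_sym.
pose p := theta^-1; pose fA i (x : E) := Acost tau0 tau1 mu i (x.1, symmx x.2).
have hA i : hasdiff (fA i) nu (fun h => tau1 * grad i nu h) by exact: hasdiff_Acost.
have := hasdiff_sum_exp (fun i => lam i * a i `^ theta) s hA.
set g := (X in hasdiff X _ _) => hg.
have gE x : g x = Z (x.1, symmx x.2) by [].
clearbody g; have gnu : g nu = Z nu by rewrite gE; congr (Zsum _ _ _ _ _ _).
exists (tau0 * (p * Z nu `^ (p - 1)) * (Z nu / s) * tau1).
  by rewrite !mulf_neq0 ?invr_eq0 ?gt_eqF ?powR_gt0.
have g0 : 0 < g nu by rewrite gnu.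
have hP := hasdiffZ tau0 (hasdiffD (hasdiff_cst (\sum_i lam i * a i) nu)
  (hasdiffZ (-1) (hasdiff_powR p g0 hg))).
rewrite (_ : (fun x => Phi _ _ _ _ _ _) =
  fun x => tau0 * (\sum_i lam i * a i + -1 * g x `^ p)); last first.
  by apply/funext => x; rewrite /Phi mulN1r gE.
apply: hasdiff_eq hP _ => h; rewrite -sum_grad gnu add0r.
rewrite (_ : \sum_i _ * _ * _ = Z nu * tau1 * \sum_i w i nu * grad i nu h); last first.
  rewrite mulr_sumr; apply: eq_bigr => i _; rewrite /omega -/(Z nu) /fA nuE.
  by field; rewrite gt_eqF.
by ring.
Qed.

Lemma devmx_sym nu : posdefmx nu.2 -> (devmx nu)^T = devmx nu.
Proof.
move=> pn; rewrite /devmx linear_sum; apply: eq_bigr => i _.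
have [pr _] := adjusted_targetP tau0_gt0 tau1_gt0 (mu_nondeg i) pn.
by rewrite linearZ/= linearD/= trmx_mul trmxK (posdef_sym pr).
Qed.

Lemma stationary_Phi nu : posdefmx nu.2 ->
  stationary_point (Phi tau0 tau1 lam a mu) nu <->
  nu.1 = \sum_i w i nu *: v i nu /\ nu.2 = devmx nu.
Proof.
move=> pn; have [c c0 [dPhi PhiE]] := hasdiff_Phi pn.
have [g1 g2] := grad_eq0 (\sum_i w i nu *: v i nu - nu.1) pn (devmx_sym pn).
rewrite /stationary_point; split=> [[_ st]|[mE SE]].
  have /g1[/subr0_eq -> ->//] : forall (h : 'cV[R]_d) (H : 'M[R]_d), H^T = H ->
      - (h^T *m invmx nu.2 *m (\sum_i w i nu *: v i nu - nu.1)) 0 0 +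
      2^-1 * \tr (H *m (invmx nu.2 - invmx nu.2 *m devmx nu *m invmx nu.2)) = 0.
  move=> h H symH; have := st (h, H); rewrite PhiE/= symmx_id// => /eqP.
  by rewrite mulf_eq0 (negbTE c0) => /eqP.
split=> // h; rewrite PhiE g2 ?mulr0//; last exact: symmx_sym.
by rewrite -mE subrr.
Qed.

End barycenter.


Theorem theorem3p11 (R : realType) (d n : nat) (tau0 tau1 : R)
    (lam a : 'I_n -> R) (mu : 'I_n -> gauss_param R d)
    (tau0_gt0 : 0 < tau0) (tau1_gt0 : 0 < tau1) (n_ge1 : (1 <= n)%N)
    (lam_gt0 : forall i, 0 < lam i) (lam_sum1 : \sum_i lam i = 1)
    (a_gt0 : forall i, 0 < a i) (mu_nondeg : forall i, nondeg_gaussian (mu i)) :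
  let F := Phi tau0 tau1 lam a mu in
  let w i nu := omega tau0 tau1 lam a mu i nu in
  let v i nu := adj_mean tau0 tau1 mu i nu in
  let Q i nu := adj_cov tau0 tau1 mu i nu in
  let T := moment_map tau0 tau1 lam a mu in
  let b nu := bstar tau0 tau1 lam a mu nu in
  let M i nu := Mstar tau0 tau1 lam a mu i nu in
  [/\ forall (m : 'cV[R]_d) (Sigma : 'M[R]_d), posdefmx Sigma ->
        let nu := (m, Sigma) in
        stationary_point F nu <->
        m = \sum_i w i nu *: v i nu /\
        Sigma = \sum_i w i nu *: (Q i nu + (v i nu - m) *m (v i nu - m)^T),
      [set nu | nondeg_gaussian nu /\ T nu = nu] =
        [set nu | nondeg_gaussian nu /\ stationary_point F nu]
    & forall nu, nondeg_gaussian nu -> stationary_point F nu ->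
        b nu = \sum_i lam i * M i nu /\
        forall i, w i nu = lam i * M i nu / b nu ].
Proof.
move=> F w v Q T b M.
have stE nu := stationary_Phi tau0_gt0 tau1_gt0 n_ge1 lam_gt0 a_gt0 mu_nondeg (nu := nu).
split.
- by move=> m Sigma pS /=; exact: (stE (m, Sigma)).
- apply/seteqP; split=> nu [pn H]; split=> //.
    (* [moment_map] centres at the mixture mean while [devmx] centres at [nu.1]; the first component
       of the fixed-point equation identifies the two centres. *)
    apply/stE => //; have mE : nu.1 = \sum_i w i nu *: v i nu by rewrite -[in LHS]H.
    by split=> //; rewrite -[in LHS]H /devmx mE.
  have [mE SE] := (stE _ pn).1 H; case: (nu) mE SE => m S mE SE.
  rewrite /T /moment_map -mE; congr pair; exact/esym.
- by move=> nu _ _; exact: bstarE.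
Qed.
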